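(* Let $R$ and $S$ be rings, $M$ a flat $R$-$R$-bimodule, $N$ an $S$-$S$-bimodule, and $n\ge 1$ a natural number. There is a homomorphism $$F^n\colon \widetilde K_0(R,S;M,N)\to \widetilde K_0(R,S;M^{\otimes_R n},N^{\otimes_S n}),$$ namely the $n$-Frobenius map defined in the context, such that: (1) $F^nF^m=F^{nm}$ for all natural numbers $n,m\ge 1$ (here $F^m$ is defined on $\widetilde K_0(R,S;M,N)$ and $F^n$ on $\widetilde K_0(R,S;M^{\otimes_R m},N^{\otimes_S m})$, and one identifies $(M^{\otimes_R m})^{\otimes_R n}=M^{\otimes_R nm}$, $(N^{\otimes_S m})^{\otimes_S n}=N^{\otimes_S nm}$); (2) for every $\phi\in\widetilde K_0(R,S;M,N)$, the image of $F^n(\phi)$ under the iterated trace map $\mathrm{tr}_\bullet$ is $$(\mathrm{tr}(F^n(\phi)),\ \mathrm{tr}(F^{2n}(\phi)),\ \mathrm{tr}(F^{3n}(\phi)),\ldots).$$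
   Context: Rings are associative with unit, not necessarily commutative. $\mathrm{Mod}^c_{R,S}$ is the category of $R$-$S$-bimodules that are finitely generated and projective as right $S$-modules, with bimodule homomorphisms. Endomorphism category. For an $R$-$R$-bimodule $M$ and an $S$-$S$-bimodule $N$, the objects of $\mathrm{End}(R,S;M,N)$ are pairs $(f,P)$ with $P\in \mathrm{Mod}^c_{R,S}$ and $f\colon M\otimes_R P\to P\otimes_S N$ an $R$-$S$-bimodule homomorphism. A morphism $(f,P)\to(g,Q)$ is a bimodule homomorphism $\varphi\colon P\to Q$ with $(\varphi\otimes \mathrm{id}_N)f=g(\mathrm{id}_M\otimes\varphi)$. A sequence is exact if the underlying sequence of bimodules is exact. $K_0(R,S;M,N)$ is the group generated by isomorphism classes of objects modulo $[f]=[f']+[f'']$ for short exact sequences $(f',P')\to (f,P)\to (f'',P'')$, and the reduced group $\widetilde K_0(R,S;M,N)$ is the cokernel of $K_0(\mathrm{Mod}^c_{R,S})\to K_0(R,S;M,N)$, $[P]\mapsto [0\colon M\otimes_R P\to P\otimes_S N]$. Frobenius. For $f\colon M\otimes_R P\to P\otimes_S N$ let $$\Gamma(f,\dots,f)=(f\otimes \mathrm{id}_{N^{\otimes n-1}})\circ(\mathrm{id}_M\otimes f\otimes \mathrm{id}_{N^{\otimes n-2}})\circ\cdots\circ(\mathrm{id}_{M^{\otimes n-1}}\otimes f)\colon M^{\otimes_R n}\otimes_R P\to P\otimes_S N^{\otimes_S n}.$$ The $n$-Frobenius map $F^n$ is the homomorphism on reduced $K_0$ induced by the exact functor $f\mapsto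 \Gamma(f,\dots,f)$ ($n$ copies). Trace. For an $R$-$R$-bimodule $M$ let $\langle\!\langle M\rangle\!\rangle=M/(rm-mr : r\in R, m\in M)$, an abelian group (and similarly over $S$). For $P\in \mathrm{Mod}^c_{R,S}$ with dual basis $(p_i,p_i^* )$ as a right $S$-module ($p_i\in P$, $p_i^*\in \mathrm{Hom}_S(P,S)$), and $f\colon M\otimes_R P\to P\otimes_S N$, the (Hattori–Stallings, bicategorical) trace $\mathrm{tr}(f)\colon \langle\!\langle M\rangle\!\rangle\to\langle\!\langle N\rangle\!\rangle$ is the homomorphism $[m]\mapsto \sum_i [(p_i^*\otimes \mathrm{id}_N)(f(m\otimes p_i))]$, where $p_i^*\otimes\mathrm{id}_N\colon P\otimes_S N\to S\otimes_S N\cong N$. It induces a homomorphism $\mathrm{tr}\colon\widetilde K_0(R,S;M,N)\to \mathrm{Hom}_{\mathbb Z}(\langle\!\langle M\rangle\!\rangle,\langle\!\langle N\rangle\!\rangle)$. Iterated trace map. $\mathrm{tr}_\bullet\colon\widetilde K_0(R,S;M,N)\to\prod_{i\ge1}\mathrm{Hom}_{\mathbb Z}(\langle\!\langle M^{\otimes_R i}\rangle\!\rangle,\langle\!\langle N^{\otimes_S i}\rangle\!\rangle)$ has $i$-th component $\phi\mapsto \mathrm{tr}(F^i(\phi))$. *)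

(* Defs.v *)
From HB Require Import structures.
From mathcomp Require Import all_boot all_algebra.
From mathcomp Require Import boolp freeg.

Set Implicit Arguments.
Unset Strict Implicit.
Unset Printing Implicit Defensive.

Import GRing.Theory.
Local Open Scope ring_scope.
Local Open Scope quotient_scope.

(* Rings are pzRingTypes: associative and unital, not necessarily commutative,
   the zero ring being allowed. *)

Section Gensub.
Variables (V : zmodType) (X : V -> Prop).

Definition gensub : {pred V} := fun v =>
  `[< forall H : zmodClosed V, (forall x, X x -> x \in H) -> v \in H >].

Lemma gensub_closed : zmod_closed gensub.
Proof.
split; first by apply/asboolP => H _; exact: rpred0.
move=> u v /asboolP uX /asboolP vX; apply/asboolP => H XH.
by rewrite rpredB ?uX ?vX.
Qed.
HB.instance Definition _ := GRing.isZmodClosed.Build V gensub gensub_closed.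

Lemma mem_gensub x : X x -> x \in gensub.
Proof. by move=> Xx; apply/asboolP => H; exact. Qed.

Definition zquot : zmodType := Quotient.quot gensub.

Definition zpi (x : V) : zquot := \pi_(Quotient.quot gensub) x.

Lemma zpi_is_additive : zmod_morphism zpi.
Proof. by move=> x y; rewrite /zpi raddfB. Qed.
HB.instance Definition _ := GRing.isZmodMorphism.Build V zquot zpi zpi_is_additive.

Lemma zpi_eq x y : X (x - y) -> zpi x = zpi y.
Proof.
by move=> Xxy; apply/eqP; rewrite -Quotient.idealrBE; exact: mem_gensub.
Qed.

Lemma zpi_surj (q : zquot) : exists x, q = zpi x.
Proof. by exists (repr q); rewrite /zpi reprK. Qed.

Variables (A : zmodType) (h : {additive V -> A}).
Hypothesis hX : forall x, X x -> h x = 0.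

Lemma zlift_ex : {g : {additive zquot -> A} | forall x, g (zpi x) = h x}.
Proof.
have hker : zmod_closed (fun v => h v == 0).
  split; first by rewrite unfold_in raddf0.
  by move=> u v /eqP hu /eqP hv; rewrite unfold_in raddfB hu hv subr0.
pose K := HB.pack_for (zmodClosed V) (fun v => h v == 0)
  (GRing.isZmodClosed.Build V _ hker).
pose g (q : zquot) := h (repr (q : Quotient.quot gensub)).
have gE x : g (zpi x) = h x.
  apply/eqP; rewrite -subr_eq0 -raddfB.
  have : repr (\pi_(Quotient.quot gensub) x) - x \in gensub.
    by rewrite Quotient.idealrBE reprK.
  by move=> /asboolP/(_ K); apply=> y Xy; rewrite unfold_in /= hX.
have gB : zmod_morphism g.
  move=> p q; have [x ->] := zpi_surj p; have [y ->] := zpi_surj q.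
  by rewrite -raddfB !gE raddfB.
by exists (HB.pack_for {additive zquot -> A} g
  (GRing.isZmodMorphism.Build zquot A g gB)).
Qed.

Definition zlift : {additive zquot -> A} := sval zlift_ex.

Lemma zliftE x : zlift (zpi x) = h x.
Proof. exact: (svalP zlift_ex). Qed.

End Gensub.

Arguments zpi : simpl never.

Lemma zquot_ext (V : zmodType) (X : V -> Prop) (A : zmodType)
    (f g : {additive zquot X -> A}) :
  (forall x, f (zpi X x) = g (zpi X x)) -> f =1 g.
Proof. by move=> fg q; have [x ->] := zpi_surj q. Qed.

HB.mixin Record Zmodule_isRmodule (S : pzRingType) V of GRing.Zmodule V := {
  ract : V -> S -> V;
  ractA : forall v s t, ract (ract v s) t = ract v (s * t);
  ract1 : forall v, ract v 1 = v;
  ractDl : forall u v s, ract (u + v) s = ract u s + ract v s;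
  ractDr : forall v s t, ract v (s + t) = ract v s + ract v t
}.
#[short(type="rmodType")]
HB.structure Definition Rmodule (S : pzRingType) :=
  {V of GRing.Zmodule V & Zmodule_isRmodule S V}.

Notation "v :* s" := (ract v s) : ring_scope.

HB.mixin Record isBimodule (R S : pzRingType) V
    of GRing.Lmodule R V & Rmodule S V := {
  scale_ractA : forall (a : R) (v : V) (s : S), (a *: v) :* s = a *: (v :* s)
}.
#[short(type="bimodType")]
HB.structure Definition Bimodule (R S : pzRingType) :=
  {V of GRing.Lmodule R V & Rmodule S V & isBimodule R S V}.

Section Regular.
Variable S : pzRingType.

HB.instance Definition _ := Zmodule_isRmodule.Build S S^o
  (fun v s t => esym (mulrA (v : S) s t)) (@mulr1 S) (@mulrDl S) (@mulrDr S).
HB.instance Definition _ := isBimodule.Build S S S^o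
  (fun a v s => esym (mulrA (a : S) (v : S) s)).

End Regular.

Record rlin (S : pzRingType) (U V : rmodType S) := Rlin {
  rlin_fun :> {additive U -> V};
  rlinZ : forall u s, rlin_fun (u :* s) = rlin_fun u :* s }.

Record bimHom (R S : pzRingType) (U V : bimodType R S) := BimHom {
  bhom :> {linear U -> V};
  bhomZr : forall u s, bhom (u :* s) = bhom u :* s }.

Definition rlin_of_bim (R S : pzRingType) (U V : bimodType R S)
    (f : bimHom U V) : rlin U V :=
  @Rlin S U V (bhom f : {additive U -> V}) (bhomZr f).
Coercion rlin_of_bim : bimHom >-> rlin.

Section Tensor.
Variables (S : pzRingType) (P : rmodType S) (Q : lmodType S).

Definition tgen (p : P) (q : Q) : {freeg (P * Q)%type / int} := << (p, q) >>.

Inductive tensor_rel : {freeg (P * Q)%type / int} -> Prop :=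
| TensorDl p p' q : tensor_rel (tgen (p + p') q - (tgen p q + tgen p' q))
| TensorDr p q q' : tensor_rel (tgen p (q + q') - (tgen p q + tgen p q'))
| TensorM p s q : tensor_rel (tgen (p :* s) q - tgen p (s *: q)).

Definition tensor : Type := zquot tensor_rel.
HB.instance Definition _ := GRing.Zmodule.on tensor.

Definition tpure (p : P) (q : Q) : tensor := zpi tensor_rel (tgen p q).

End Tensor.

Notation "p *t q" := (tpure p q) (at level 40, left associativity) : ring_scope.

Record balanced (S : pzRingType) (P : rmodType S) (Q : lmodType S)
    (A : zmodType) := Balanced {
  bal_fun :> P -> Q -> A;
  balDl : forall p p' q, bal_fun (p + p') q = bal_fun p q + bal_fun p' q;
  balDr : forall p q q', bal_fun p (q + q') = bal_fun p q + bal_fun p q';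
  balM : forall p s q, bal_fun (p :* s) q = bal_fun p (s *: q) }.

Section TensorTheory.
Variables (S : pzRingType) (P : rmodType S) (Q : lmodType S).

Lemma tpureDl (p p' : P) (q : Q) : (p + p') *t q = p *t q + p' *t q.
Proof. by rewrite /tpure -raddfD; exact: (zpi_eq (TensorDl p p' q)). Qed.

Lemma tpureDr (p : P) (q q' : Q) : p *t (q + q') = p *t q + p *t q'.
Proof. by rewrite /tpure -raddfD; exact: (zpi_eq (TensorDr p q q')). Qed.

Lemma tpureM (p : P) s (q : Q) : (p :* s) *t q = p *t (s *: q).
Proof. exact: (zpi_eq (TensorM p s q)). Qed.

Lemma tpure0l (q : Q) : (0 : P) *t q = 0.
Proof. by apply: (addrI ((0 : P) *t q)); rewrite -tpureDl !addr0. Qed.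

Lemma tpure0r (p : P) : p *t (0 : Q) = 0.
Proof. by apply: (addrI (p *t (0 : Q))); rewrite -tpureDr !addr0. Qed.

Lemma tpure_suml I (r : seq I) (F : I -> P) (q : Q) :
  (\sum_(i <- r) F i) *t q = \sum_(i <- r) F i *t q.
Proof. exact: (big_morph (fun p => p *t q) (fun p p' => tpureDl p p' q) (tpure0l q)). Qed.

Lemma tpure_sumr I (r : seq I) (p : P) (F : I -> Q) :
  p *t (\sum_(i <- r) F i) = \sum_(i <- r) p *t F i.
Proof. exact: (big_morph (fun q => p *t q) (tpureDr p) (tpure0r p)). Qed.

Lemma tensor_ind (K : tensor P Q -> Prop) :
    K 0 -> (forall p q, K (p *t q)) -> (forall x y, K x -> K y -> K (x - y)) ->
  forall x, K x.
Proof.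
move=> K0 Kp KB x; have KN y : K y -> K (- y) by rewrite -sub0r; exact: KB.
have KD y z : K y -> K z -> K (y + z).
  by move=> Ky Kz; rewrite -[z]opprK; apply: KB => //; exact: KN.
have [y ->] := zpi_surj x; rewrite -[y]freeg_repr.
have -> (s : seq (int * (P * Q))) :
    [freeg s] = \sum_(i <- s) << i.1 *g i.2 >> :> {freeg (P * Q)%type / int}.
  elim: s => [|[z u] s IHs]; first by rewrite big_nil.
  rewrite big_cons -IHs; apply/eqP/freeg_eqP => w.
  by rewrite coeffD !coeff_Freeg !precoeff_cons precoeff_nil addr0.
rewrite raddf_sum; apply: (big_ind K) => // -[z [p q]] _ /=.
have -> : << z *g (p, q) >> = tgen p q *~ z.
  apply/eqP/freeg_eqP => w; rewrite raddfMz /= !coeffU.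
  by rewrite mul1r -mulrzr intz mulrC.
rewrite raddfMz.
have KM n : K (p *t q *+ n).
  by elim: n => [|n IHn]; rewrite ?mulr0n // mulrS; apply: KD.
by case: z => n; [rewrite -pmulrn | rewrite NegzE mulrNz -pmulrn; apply: KN];
  apply: KM.
Qed.

Section Lift.
Variables (A : zmodType) (b : balanced P Q A).

Definition tlift_free_fun (x : {freeg (P * Q)%type / int}) : A :=
  fglift (fun u => b u.1 u.2 : zmodule A) x.

Lemma tlift_free_is_additive : zmod_morphism tlift_free_fun.
Proof. exact: (lift_is_additive (fun u => b u.1 u.2 : zmodule A)). Qed.
HB.instance Definition _ := GRing.isZmodMorphism.Build
  {freeg (P * Q)%type / int} A tlift_free_fun tlift_free_is_additive.

Lemma tlift_free_gen p q : tlift_free_fun (tgen p q) = b p q.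
Proof. by rewrite /tlift_free_fun /tgen liftU scale1r. Qed.

Lemma tlift_free_rel x : tensor_rel x -> tlift_free_fun x = 0.
Proof.
case=> [p p' q|p q q'|p s q]; rewrite raddfB ?raddfD /= !tlift_free_gen.
- by rewrite balDl -opprD subrr.
- by rewrite balDr -opprD subrr.
- by rewrite balM subrr.
Qed.

Definition tlift : {additive tensor P Q -> A} := zlift tlift_free_rel.

Lemma tliftE p q : tlift (p *t q) = b p q.
Proof. by rewrite /tlift /tpure zliftE /= tlift_free_gen. Qed.

Lemma tensor_ext (f g : {additive tensor P Q -> A}) :
  (forall p q, f (p *t q) = g (p *t q)) -> f =1 g.
Proof.
by move=> fg; apply: tensor_ind => [|//|x y]; rewrite ?raddf0 // !raddfB => -> ->.
Qed.

End Lift.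
End TensorTheory.

Section TensorMap.
Variables (S : pzRingType) (P P' : rmodType S) (Q Q' : lmodType S).
Variables (f : rlin P P') (g : {linear Q -> Q'}).

Program Definition tmap_bal : balanced P Q (tensor P' Q') :=
  @Balanced _ _ _ _ (fun p q => f p *t g q) _ _ _.
Next Obligation. by rewrite raddfD tpureDl. Qed.
Next Obligation. by rewrite raddfD tpureDr. Qed.
Next Obligation. by rewrite rlinZ linearZ tpureM. Qed.

Definition tmap : {additive tensor P Q -> tensor P' Q'} := tlift tmap_bal.

Lemma tmapE p q : tmap (p *t q) = f p *t g q.
Proof. exact: tliftE. Qed.

End TensorMap.

Definition rid (S : pzRingType) (P : rmodType S) : rlin P P :=
  @Rlin S P P idfun (fun _ _ => erefl).

Section TensorLeft.
Variables (R S : pzRingType) (P : bimodType R S) (Q : lmodType S).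

Let lmul_is_additive (a : R) : zmod_morphism (fun p : P => a *: p).
Proof. by move=> x y; rewrite scalerBr. Qed.

Definition lmul (a : R) : rlin P P :=
  @Rlin S P P (HB.pack_for {additive P -> P} (fun p : P => a *: p)
    (GRing.isZmodMorphism.Build P P _ (lmul_is_additive a)))
    (fun p s => esym (scale_ractA a p s)).

Definition tscale (a : R) (x : tensor P Q) : tensor P Q := tmap (lmul a) idfun x.

Lemma tscaleE a (p : P) (q : Q) : tscale a (p *t q) = (a *: p) *t q.
Proof. exact: tmapE. Qed.

Lemma tscaleA a b x : tscale a (tscale b x) = tscale (a * b) x.
Proof.
rewrite /tscale -[LHS]/((tmap (lmul a) idfun \o tmap (lmul b) idfun) x).
by move: x; apply: tensor_ext => p q; rewrite /= !tmapE /= scalerA.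
Qed.

Lemma tscale1 : left_id 1 tscale.
Proof.
move=> x; rewrite -[RHS]/(idfun x) /tscale; move: x.
by apply: tensor_ext => p q; rewrite tmapE /= scale1r.
Qed.

Lemma tscaleDr : right_distributive tscale +%R.
Proof. by move=> a x y; rewrite /tscale raddfD. Qed.

Lemma tscaleDl x : {morph tscale^~ x : a b / a + b}.
Proof.
move=> a b /=; rewrite /tscale -[RHS]/((tmap (lmul a) idfun \+ tmap (lmul b) idfun) x).
by move: x; apply: tensor_ext => p q; rewrite /= !tmapE /= scalerDl tpureDl.
Qed.

HB.instance Definition _ := GRing.Zmodule_isLmodule.Build R (tensor P Q)
  tscaleA tscale1 tscaleDr tscaleDl.

Lemma tpureZl a (p : P) (q : Q) : a *: (p *t q) = (a *: p) *t q.
Proof. exact: tscaleE. Qed.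

End TensorLeft.

Section TensorRight.
Variables (S T : pzRingType) (P : rmodType S) (Q : bimodType S T).

Let rmul_is_linear (t : T) : linear (fun q : Q => q :* t).
Proof. by move=> a x y; rewrite ractDl scale_ractA. Qed.

Definition rmul (t : T) : {linear Q -> Q} :=
  HB.pack_for {linear Q -> Q} (fun q : Q => q :* t)
    (GRing.isLinear.Build S Q Q *:%R _ (rmul_is_linear t)).

Definition tract (x : tensor P Q) (t : T) : tensor P Q := tmap (rid P) (rmul t) x.

Lemma tractE (p : P) (q : Q) t : tract (p *t q) t = p *t (q :* t).
Proof. exact: tmapE. Qed.

Lemma tractA x s t : tract (tract x s) t = tract x (s * t).
Proof.
rewrite /tract -[LHS]/((tmap (rid P) (rmul t) \o tmap (rid P) (rmul s)) x).
by move: x; apply: tensor_ext => p q; rewrite /= !tmapE /= ractA.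
Qed.

Lemma tract1 x : tract x 1 = x.
Proof.
rewrite -[RHS]/(idfun x) /tract; move: x.
by apply: tensor_ext => p q; rewrite tmapE /= ract1.
Qed.

Lemma tractDl x y t : tract (x + y) t = tract x t + tract y t.
Proof. by rewrite /tract raddfD. Qed.

Lemma tractDr x s t : tract x (s + t) = tract x s + tract x t.
Proof.
rewrite /tract -[RHS]/((tmap (rid P) (rmul s) \+ tmap (rid P) (rmul t)) x).
by move: x; apply: tensor_ext => p q; rewrite /= !tmapE /= ractDr tpureDr.
Qed.

HB.instance Definition _ := Zmodule_isRmodule.Build T (tensor P Q)
  tractA tract1 tractDl tractDr.

Lemma tpureZr (p : P) (q : Q) t : (p *t q) :* t = p *t (q :* t).
Proof. exact: tractE. Qed.

End TensorRight.

Section TensorBimodule.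
Variables (R S T : pzRingType) (P : bimodType R S) (Q : bimodType S T).

Lemma tensor_scale_ractA (a : R) (x : tensor P Q) (t : T) :
  (a *: x) :* t = a *: (x :* t).
Proof.
rewrite -[LHS]/((tmap (rid P) (rmul Q t) \o tmap (lmul P a) idfun) x).
rewrite -[RHS]/((tmap (lmul P a) idfun \o tmap (rid P) (rmul Q t)) x).
by move: x; apply: tensor_ext => p q; rewrite /= !tmapE.
Qed.

HB.instance Definition _ := isBimodule.Build R T (tensor P Q) tensor_scale_ractA.

Definition tens : bimodType R T := tensor P Q.

End TensorBimodule.

Notation "P *ox Q" := (tens P Q) (at level 40, left associativity).

Section TensTheory.
Variables (R S T : pzRingType) (P : bimodType R S) (Q : bimodType S T).

Lemma tensZl a (p : P) (q : Q) : a *: (p *t q : P *ox Q) = (a *: p) *t q.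
Proof. exact: tscaleE. Qed.

Lemma tensZr (p : P) (q : Q) t : (p *t q : P *ox Q) :* t = p *t (q :* t).
Proof. exact: tractE. Qed.

End TensTheory.

Section MkBim.
Variables (R S : pzRingType) (U V : bimodType R S) (f : {additive U -> V}).
Hypotheses (fZl : forall a u, f (a *: u) = a *: f u)
           (fZr : forall u s, f (u :* s) = f u :* s).

Let f_lin : linear f.
Proof. by move=> a u v; rewrite raddfD fZl. Qed.

Definition mk_bim : bimHom U V :=
  @BimHom R S U V (HB.pack_for {linear U -> V} (f : U -> V)
    (GRing.isLinear.Build R U V *:%R f f_lin)) fZr.

End MkBim.

Lemma bim_ext (R S T : pzRingType) (P : bimodType R S) (Q : bimodType S T)
    (W : bimodType R T) (f g : bimHom (P *ox Q) W) :
  (forall p q, f (p *t q) = g (p *t q)) -> f =1 g.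
Proof. exact: (@tensor_ext S P Q W f g). Qed.

Definition bid (R S : pzRingType) (U : bimodType R S) : bimHom U U :=
  @BimHom R S U U idfun (fun _ _ => erefl).

Definition bcomp (R S : pzRingType) (U V W : bimodType R S)
    (g : bimHom V W) (f : bimHom U V) : bimHom U W.
Proof.
by refine (@BimHom R S U W (g \o f) _) => u s /=; rewrite !bhomZr.
Defined.

Definition bzero (R S : pzRingType) (U V : bimodType R S) : bimHom U V.
Proof.
by refine (@mk_bim R S U V \0 _ _) => [a u|u s] /=;
  [rewrite scaler0 | apply: (addrI (0 :* s)); rewrite -ractDl !addr0].
Defined.

Lemma bmap_ex (R S T : pzRingType) (P P' : bimodType R S)
    (Q Q' : bimodType S T) (f : bimHom P P') (g : bimHom Q Q') :
  {h : bimHom (P *ox Q) (P' *ox Q') | forall p q, h (p *t q) = f p *t g q}.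
Proof.
have hZl a (x : P *ox Q) :
    (tmap f g (a *: x) : P' *ox Q') = a *: (tmap f g x : P' *ox Q').
  move: x; apply: (@tensor_ext S P Q (P' *ox Q')
    (tmap f g \o @GRing.scale R (P *ox Q) a)
    (@GRing.scale R (P' *ox Q') a \o tmap f g)) => p q.
  by rewrite /= tpureZl !tmapE /= linearZ.
have hZr (x : P *ox Q) t :
    (tmap f g (x :* t) : P' *ox Q') = (tmap f g x : P' *ox Q') :* t.
  rewrite -[LHS]/((tmap f g \o tmap (rid P) (rmul Q t)) x).
  rewrite -[RHS]/((tmap (rid P') (rmul Q' t) \o tmap f g) x).
  by move: x; apply: tensor_ext => p q; rewrite /= !tmapE /= bhomZr.
by exists (@mk_bim R T (P *ox Q) (P' *ox Q') (tmap f g) hZl hZr) => p q; exact: tmapE.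
Qed.

Definition bmap (R S T : pzRingType) (P P' : bimodType R S)
    (Q Q' : bimodType S T) (f : bimHom P P') (g : bimHom Q Q') :
  bimHom (P *ox Q) (P' *ox Q') := sval (bmap_ex f g).

Lemma bmapE (R S T : pzRingType) (P P' : bimodType R S) (Q Q' : bimodType S T)
    (f : bimHom P P') (g : bimHom Q Q') p q :
  bmap f g (p *t q) = f p *t g q.
Proof. exact: (svalP (bmap_ex f g)). Qed.

Record bimIso (R S : pzRingType) (U V : bimodType R S) := BimIso {
  bto :> bimHom U V;
  bfrom : bimHom V U;
  btoK : cancel bto bfrom;
  bfromK : cancel bfrom bto }.

Definition iso_id (R S : pzRingType) (U : bimodType R S) : bimIso U U :=
  @BimIso R S U U (bid U) (bid U) (fun _ => erefl) (fun _ => erefl).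

Definition iso_comp (R S : pzRingType) (U V W : bimodType R S)
    (g : bimIso V W) (f : bimIso U V) : bimIso U W :=
  @BimIso R S U W (bcomp g f) (bcomp (bfrom f) (bfrom g))
    (can_comp (btoK g) (btoK f)) (can_comp (bfromK f) (bfromK g)).

Definition iso_map (R S T : pzRingType) (P P' : bimodType R S)
    (Q Q' : bimodType S T) (f : bimIso P P') (g : bimIso Q Q') :
  bimIso (P *ox Q) (P' *ox Q').
Proof.
apply: (@BimIso R T _ _ (bmap f g) (bmap (bfrom f) (bfrom g))).
  apply: (@bim_ext _ _ _ _ _ _ (bcomp (bmap (bfrom f) (bfrom g)) (bmap f g)) (bid _)).
  by move=> p q; rewrite /= !bmapE /= !btoK.
apply: (@bim_ext _ _ _ _ _ _ (bcomp (bmap f g) (bmap (bfrom f) (bfrom g))) (bid _)).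
by move=> p q; rewrite /= !bmapE /= !bfromK.
Defined.

Section Assoc.
Variables (R S T U : pzRingType).
Variables (P : bimodType R S) (Q : bimodType S T) (W : bimodType T U).

Lemma tensor3_extl (A : zmodType) (f g : {additive tensor (P *ox Q) W -> A}) :
  (forall p q w, f ((p *t q) *t w) = g ((p *t q) *t w)) -> f =1 g.
Proof.
move=> fg; apply: tensor_ext => x w; move: x.
have addl (h : {additive tensor (P *ox Q) W -> A}) :
    zmod_morphism (fun x : tensor P Q => h (x *t w)).
  by move=> x y; apply: (addIr (h (y *t w))); rewrite subrK -raddfD -tpureDl subrK.
pose F (h : {additive tensor (P *ox Q) W -> A}) := HB.pack_for {additive tensor P Q -> A}
  (fun x : tensor P Q => h (x *t w)) (GRing.isZmodMorphism.Build _ A _ (addl h)).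
exact: (@tensor_ext S P Q A (F f) (F g) (fun p q => fg p q w)).
Qed.

Lemma tensor3_extr (A : zmodType) (f g : {additive tensor P (Q *ox W) -> A}) :
  (forall p q w, f (p *t (q *t w)) = g (p *t (q *t w))) -> f =1 g.
Proof.
move=> fg; apply: tensor_ext => p.
have addr (h : {additive tensor P (Q *ox W) -> A}) :
    zmod_morphism (fun x : tensor Q W => h (p *t x)).
  by move=> x y; apply: (addIr (h (p *t y))); rewrite subrK -raddfD -tpureDr subrK.
pose F (h : {additive tensor P (Q *ox W) -> A}) := HB.pack_for {additive tensor Q W -> A}
  (fun x : tensor Q W => h (p *t x)) (GRing.isZmodMorphism.Build _ A _ (addr h)).
exact: (@tensor_ext T Q W A (F f) (F g) (fg p)).
Qed.

Local Definition assoc_in (w : W) : balanced P Q (P *ox (Q *ox W)).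
Proof.
refine (@Balanced S P Q (P *ox (Q *ox W)) (fun p q => p *t (q *t w)) _ _ _).
- by move=> p p' q; rewrite tpureDl.
- by move=> p q q'; rewrite tpureDl tpureDr.
- by move=> p s q; rewrite tpureM tpureZl.
Defined.

Local Definition assoc_bal : balanced (P *ox Q) W (P *ox (Q *ox W)).
Proof.
refine (@Balanced T (P *ox Q) W (P *ox (Q *ox W)) (fun x w => tlift (assoc_in w) x) _ _ _).
- by move=> x x' w; rewrite raddfD.
- move=> x w w'; rewrite -[RHS]/((tlift (assoc_in w) \+ tlift (assoc_in w')) x).
  by move: x; apply: tensor_ext => p q; rewrite /= !tliftE /= !tpureDr.
- move=> x t w; rewrite -[LHS]/((tlift (assoc_in w) \o tmap (rid P) (rmul Q t)) x).
  move: x; apply: tensor_ext => p q.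
  by rewrite /= tmapE !tliftE /= tpureM.
Defined.

Local Definition assoc_fun : {additive tensor (P *ox Q) W -> P *ox (Q *ox W)} :=
  tlift assoc_bal.

Local Lemma assoc_funE p q w : assoc_fun ((p *t q) *t w) = p *t (q *t w).
Proof. by rewrite /assoc_fun tliftE /= tliftE. Qed.

Local Definition cossa_in (p : P) : balanced Q W ((P *ox Q) *ox W).
Proof.
refine (@Balanced T Q W ((P *ox Q) *ox W) (fun q w => (p *t q) *t w) _ _ _).
- by move=> q q' w; rewrite tpureDr tpureDl.
- by move=> q w w'; rewrite tpureDr.
- by move=> q t w; rewrite -tpureM tpureZr.
Defined.

Local Definition cossa_bal : balanced P (Q *ox W) ((P *ox Q) *ox W).
Proof.
refine (@Balanced S P (Q *ox W) ((P *ox Q) *ox W) (fun p x => tlift (cossa_in p) x) _ _ _).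
- move=> p p' x; rewrite -[RHS]/((tlift (cossa_in p) \+ tlift (cossa_in p')) x).
  by move: x; apply: tensor_ext => q w; rewrite /= !tliftE /= !tpureDl.
- by move=> p x x'; rewrite raddfD.
- move=> p s x; rewrite -[RHS]/((tlift (cossa_in p) \o tmap (lmul Q s) idfun) x).
  move: x; apply: tensor_ext => q w.
  by rewrite /= tmapE !tliftE /= tpureM.
Defined.

Local Definition cossa_fun : {additive tensor P (Q *ox W) -> (P *ox Q) *ox W} :=
  tlift cossa_bal.

Local Lemma cossa_funE p q w : cossa_fun (p *t (q *t w)) = (p *t q) *t w.
Proof. by rewrite /cossa_fun tliftE /= tliftE. Qed.

Lemma assoc_ex : {h : bimIso ((P *ox Q) *ox W) (P *ox (Q *ox W)) |
  forall p q w, h ((p *t q) *t w) = p *t (q *t w)}.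
Proof.
have hZl a (x : (P *ox Q) *ox W) : assoc_fun (a *: x) = a *: assoc_fun x.
  move: x; apply: (@tensor3_extl _ (assoc_fun \o @GRing.scale R ((P *ox Q) *ox W) a)
    (@GRing.scale R (P *ox (Q *ox W)) a \o assoc_fun)) => p q w.
  by rewrite /= tpureZl assoc_funE tpureZl assoc_funE tpureZl.
have hZr (x : (P *ox Q) *ox W) u : assoc_fun (x :* u) = assoc_fun x :* u.
  rewrite -[LHS]/((assoc_fun \o tmap (rid (P *ox Q)) (rmul W u)) x).
  rewrite -[RHS]/((tmap (rid P) (rmul (Q *ox W) u) \o assoc_fun) x).
  move: x; apply: tensor3_extl => p q w.
  by rewrite /= tmapE !assoc_funE tmapE /= tpureZr.
have fK : cancel assoc_fun cossa_fun.
  apply: (@tensor3_extl _ (cossa_fun \o assoc_fun) idfun) => p q w.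
  by rewrite /= assoc_funE cossa_funE.
have gK : cancel cossa_fun assoc_fun.
  apply: (@tensor3_extr _ (assoc_fun \o cossa_fun) idfun) => p q w.
  by rewrite /= cossa_funE assoc_funE.
have gZl a x : cossa_fun (a *: x) = a *: cossa_fun x.
  by rewrite -{1}[x]gK -hZl fK.
have gZr x u : cossa_fun (x :* u) = cossa_fun x :* u.
  by rewrite -{1}[x]gK -hZr fK.
exists (@BimIso R U _ _
  (@mk_bim R U ((P *ox Q) *ox W) (P *ox (Q *ox W)) assoc_fun hZl hZr)
  (@mk_bim R U (P *ox (Q *ox W)) ((P *ox Q) *ox W) cossa_fun gZl gZr) fK gK).
exact: assoc_funE.
Qed.

End Assoc.

Definition assoc (R S T U : pzRingType) (P : bimodType R S)
    (Q : bimodType S T) (W : bimodType T U) :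
  bimIso ((P *ox Q) *ox W) (P *ox (Q *ox W)) := sval (assoc_ex P Q W).

Lemma assocE (R S T U : pzRingType) (P : bimodType R S)
    (Q : bimodType S T) (W : bimodType T U) p q w :
  assoc P Q W ((p *t q) *t w) = p *t (q *t w).
Proof. exact: (svalP (assoc_ex P Q W)). Qed.

Lemma assocVE (R S T U : pzRingType) (P : bimodType R S)
    (Q : bimodType S T) (W : bimodType T U) p q w :
  bfrom (assoc P Q W) (p *t (q *t w)) = (p *t q) *t w.
Proof. by rewrite -assocE btoK. Qed.

(* tpow M n is the n-fold tensor power of M for n >= 1, bracketed to the right;
   tpow M 0 = M is a dummy value. *)
Fixpoint tpow (R : pzRingType) (M : bimodType R R) (n : nat) : bimodType R R :=
  if n is n'.+1 then (if n' is 0 then M else M *ox tpow M n') else M.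

Definition tpow_cast (R : pzRingType) (M : bimodType R R) (m n : nat)
    (e : m = n) : bimIso (tpow M m) (tpow M n) :=
  let: erefl := e in iso_id (tpow M m).

(* M^(a+1) (x) M^(b+1) = M^((a+1)+(b+1)), by reassociating. *)
Fixpoint tpow_add (R : pzRingType) (M : bimodType R R) (a b : nat) :
    bimIso (tpow M a.+1 *ox tpow M b.+1) (tpow M (a.+1 + b.+1)) :=
  match a with
  | 0 => iso_id (M *ox tpow M b.+1)
  | a'.+1 => iso_comp (iso_map (iso_id M) (tpow_add M a' b))
                      (assoc M (tpow M a'.+1) (tpow M b.+1))
  end.

(* (M^(m+1))^(n+1) = M^((n+1)(m+1)), by reassociating; this is the map removing
   the parentheses from pure tensors. *)
Fixpoint tpow_mul (R : pzRingType) (M : bimodType R R) (n m : nat) :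
    bimIso (tpow (tpow M m.+1) n.+1) (tpow M (n.+1 * m.+1)) :=
  match n with
  | 0 => tpow_cast M (esym (mul1n m.+1))
  | n'.+1 => iso_comp (tpow_add M m (m + n' * m.+1))
                      (iso_map (iso_id (tpow M m.+1)) (tpow_mul M n' m))
  end.

(* The collection of all bimodules lives in a universe above that of the
   carriers of zmodTypes, so K_0 groups cannot be zmodTypes. *)

Record abGroup := AbGroup {
  ab_sort :> Type;
  ab0 : ab_sort;
  abopp : ab_sort -> ab_sort;
  abadd : ab_sort -> ab_sort -> ab_sort;
  abaddA : associative abadd;
  abaddC : commutative abadd;
  abadd0 : left_id ab0 abadd;
  abaddN : left_inverse ab0 abopp abadd }.

Declare Scope ab_scope.
Delimit Scope ab_scope with AB.
Notation "x + y" := (abadd x y) : ab_scope.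
Notation "- x" := (abopp x) : ab_scope.
Arguments ab0 {_}.

Record abHom (A B : abGroup) := AbHom {
  ab_fun :> A -> B;
  abhomD : forall x y, ab_fun (x + y)%AB = (ab_fun x + ab_fun y)%AB }.

Section AbTheory.
Local Open Scope ab_scope.

Lemma ab_addI (A : abGroup) (x y z : A) : x + y = x + z -> y = z.
Proof.
by move=> /(congr1 (abadd (- x))); rewrite !abaddA !abaddN !abadd0.
Qed.

Variables A B C : abGroup.

Lemma abhom0 (f : abHom A B) : f ab0 = ab0.
Proof.
by apply: (@ab_addI B (f ab0)); rewrite -abhomD abadd0 abaddC abadd0.
Qed.

Lemma abhomN (f : abHom A B) x : f (- x) = - f x.
Proof.
by apply: (@ab_addI B (f x)); rewrite -abhomD !(abaddC _ (- _)) !abaddN abhom0.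
Qed.

Lemma abopp0 (G : abGroup) : - ab0 = ab0 :> G.
Proof. by rewrite -[LHS]abadd0 abaddC abaddN. Qed.

Definition abcomp (g : abHom B C) (f : abHom A B) : abHom A C.
Proof. by exists (g \o f) => x y /=; rewrite !abhomD. Defined.

End AbTheory.

Section Equot.
Variables (T : Type) (E : T -> T -> Prop).
Hypotheses (Erefl : forall x, E x x) (Esym : forall x y, E x y -> E y x)
  (Etrans : forall x y z, E x y -> E y z -> E x z).

Definition equot := {C : T -> Prop | exists x, C = E x}.
Definition ecls (x : T) : equot := exist _ (E x) (ex_intro _ x erefl).

Lemma ecls_eq x y : E x y -> ecls x = ecls y.
Proof.
move=> Exy; apply: eq_exist => /=; apply: funext => z; apply: propext.
by split=> H; [apply: Etrans (Esym Exy) H | apply: Etrans Exy H].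
Qed.

Lemma ecls_inj x y : ecls x = ecls y -> E x y.
Proof. by move=> /(congr1 sval) /= ->. Qed.

Lemma ecls_surj (q : equot) : exists x, q = ecls x.
Proof. by case: q => C [x Cx]; exists x; apply: eq_exist. Qed.

Definition erepr (q : equot) : T := sval (cid (ecls_surj q)).

Lemma erepr_cls x : E (erepr (ecls x)) x.
Proof.
by rewrite /erepr; case: cid => y /= /ecls_inj; exact: Esym.
Qed.

Lemma ereprK q : ecls (erepr q) = q.
Proof. by rewrite /erepr; case: cid. Qed.

End Equot.

Section AbCoker.
Variables (A B : abGroup) (h : abHom A B).
Local Open Scope ab_scope.

Definition coker_eq (x y : B) : Prop := exists a, x = y + h a.

Lemma coker_refl x : coker_eq x x.
Proof. by exists ab0; rewrite abhom0 abaddC abadd0. Qed.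

Lemma coker_sym x y : coker_eq x y -> coker_eq y x.
Proof.
move=> [a ->]; exists (- a); rewrite abhomN -abaddA (abaddC (h a)) abaddN.
by rewrite abaddC abadd0.
Qed.

Lemma coker_trans x y z : coker_eq x y -> coker_eq y z -> coker_eq x z.
Proof. by move=> [a ->] [b ->]; exists (b + a); rewrite abhomD abaddA. Qed.

Lemma coker_D x x' y y' :
  coker_eq x x' -> coker_eq y y' -> coker_eq (x + y) (x' + y').
Proof.
move=> [a ->] [b ->]; exists (a + b); rewrite abhomD -!abaddA.
by congr (_ + _); rewrite !abaddA (abaddC y').
Qed.

Lemma coker_N x x' : coker_eq x x' -> coker_eq (- x) (- x').
Proof.
move=> [a ->]; exists (- a); rewrite abhomN; apply: (@ab_addI _ (x' + h a)).
rewrite (abaddC _ (- (x' + h a))) abaddN -abaddA (abaddC (h a)) -(abaddA (- x')).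
by rewrite abaddN (abaddC (- x')) abadd0 (abaddC x') abaddN.
Qed.

Definition coker_sort : Type := equot coker_eq.
Notation cls := (ecls coker_eq).

Let clsP := ecls_eq coker_sym coker_trans.
Let reprP x : coker_eq (erepr (cls x)) x := erepr_cls coker_refl coker_sym x.

Definition coker_add (p q : coker_sort) : coker_sort := cls (erepr p + erepr q).
Definition coker_opp (p : coker_sort) : coker_sort := cls (- erepr p).

Lemma coker_addE x y : coker_add (cls x) (cls y) = cls (x + y).
Proof. by apply: clsP; apply: coker_D; apply: reprP. Qed.

Lemma coker_oppE x : coker_opp (cls x) = cls (- x).
Proof. by apply: clsP; apply: coker_N; apply: reprP. Qed.

Fact coker_addA : associative coker_add.
Proof.
move=> p q r; have [x ->] := ecls_surj p; have [y ->] := ecls_surj q.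
by have [z ->] := ecls_surj r; rewrite !coker_addE abaddA.
Qed.

Fact coker_addC : commutative coker_add.
Proof.
move=> p q; have [x ->] := ecls_surj p; have [y ->] := ecls_surj q.
by rewrite !coker_addE abaddC.
Qed.

Fact coker_add0 : left_id (cls ab0) coker_add.
Proof. by move=> p; have [x ->] := ecls_surj p; rewrite coker_addE abadd0. Qed.

Fact coker_addN : left_inverse (cls ab0) coker_opp coker_add.
Proof.
by move=> p; have [x ->] := ecls_surj p; rewrite coker_oppE coker_addE abaddN.
Qed.

Definition coker : abGroup :=
  AbGroup coker_addA coker_addC coker_add0 coker_addN.

Definition coker_pi : abHom B coker.
Proof. by exists (fun x : B => cls x : coker) => x y; rewrite -coker_addE. Defined.

Lemma coker_pi_surj (q : coker) : exists x, q = coker_pi x.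
Proof. exact: ecls_surj. Qed.

Lemma coker_pi0 a : coker_pi (h a) = ab0.
Proof. by apply: clsP; exists a; rewrite abadd0. Qed.

Lemma coker_lift_ex (C : abGroup) (g : abHom B C) :
    (forall a, g (h a) = ab0) ->
  {k : abHom coker C | forall x, k (coker_pi x) = g x}.
Proof.
move=> gh; have gE x : g (erepr (cls x)) = g x.
  by have [a ->] := reprP x; rewrite abhomD gh abaddC abadd0.
have kD (p q : coker) : g (erepr (p + q)) = g (erepr p) + g (erepr q).
  have [x ->] := ecls_surj p; have [y ->] := ecls_surj q.
  by rewrite [X in erepr X]coker_addE !gE abhomD.
by exists (@AbHom coker C (fun q => g (erepr q)) kD).
Qed.

Definition coker_lift (C : abGroup) (g : abHom B C)
    (gh : forall a, g (h a) = ab0) : abHom coker C := sval (coker_lift_ex gh).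

Lemma coker_liftE (C : abGroup) (g : abHom B C)
    (gh : forall a, g (h a) = ab0) x : coker_lift gh (coker_pi x) = g x.
Proof. exact: (svalP (coker_lift_ex gh)). Qed.

End AbCoker.

Section HomGroup.
Variables A B : zmodType.

Lemma additive_eq (f g : {additive A -> B}) : f =1 g -> f = g.
Proof.
case: f g => [f [[hf]]] [g [[hg]]] /= /funext fg; subst g.
by rewrite (Prop_irrelevance hf hg).
Qed.

Let addh (f g : {additive A -> B}) : {additive A -> B} := f \+ g.
Let opph (f : {additive A -> B}) : {additive A -> B} := \- f.
Let zeroh : {additive A -> B} := \0.

Fact homg_addA : associative addh.
Proof. by move=> f g h; apply: additive_eq => x; rewrite /= addrA. Qed.
Fact homg_addC : commutative addh.
Proof. by move=> f g; apply: additive_eq => x; rewrite /= addrC. Qed.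
Fact homg_add0 : left_id zeroh addh.
Proof. by move=> f; apply: additive_eq => x; rewrite /= add0r. Qed.
Fact homg_addN : left_inverse zeroh opph addh.
Proof. by move=> f; apply: additive_eq => x; rewrite /= addNr. Qed.

Definition homg : abGroup := AbGroup homg_addA homg_addC homg_add0 homg_addN.

End HomGroup.

(* X is a collection of objects, iso the isomorphism relation and ses A B C says
   that there is a short exact sequence A -> B -> C. *)
Section K0.
Variables (X : Type) (iso : X -> X -> Prop) (ses : X -> X -> X -> Prop).

Inductive K0word :=
  | K0gen of X | K0zero | K0opp of K0word | K0add of K0word & K0word.

(* The least congruence that makes K0word an abelian group, identifies isomorphic
   objects and is additive on short exact sequences. *)
Inductive K0eq : K0word -> K0word -> Prop :=
| K0eq_refl x : K0eq x x
| K0eq_sym x y : K0eq x y -> K0eq y x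
| K0eq_trans x y z : K0eq x y -> K0eq y z -> K0eq x z
| K0eq_opp x x' : K0eq x x' -> K0eq (K0opp x) (K0opp x')
| K0eq_add x x' y y' :
    K0eq x x' -> K0eq y y' -> K0eq (K0add x y) (K0add x' y')
| K0eq_addA x y z : K0eq (K0add x (K0add y z)) (K0add (K0add x y) z)
| K0eq_addC x y : K0eq (K0add x y) (K0add y x)
| K0eq_add0 x : K0eq (K0add K0zero x) x
| K0eq_addN x : K0eq (K0add (K0opp x) x) K0zero
| K0eq_iso A B : iso A B -> K0eq (K0gen A) (K0gen B)
| K0eq_ses A B C : ses A B C -> K0eq (K0gen B) (K0add (K0gen A) (K0gen C)).

Definition K0sort : Type := equot K0eq.
Notation cls := (ecls K0eq).

Let clsP := ecls_eq K0eq_sym K0eq_trans.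
Let reprP x : K0eq (erepr (cls x)) x := erepr_cls K0eq_refl K0eq_sym x.

Definition K0sort_add (p q : K0sort) : K0sort := cls (K0add (erepr p) (erepr q)).
Definition K0sort_opp (p : K0sort) : K0sort := cls (K0opp (erepr p)).

Lemma K0sort_addE x y : K0sort_add (cls x) (cls y) = cls (K0add x y).
Proof. by apply: clsP; apply: K0eq_add; apply: reprP. Qed.

Lemma K0sort_oppE x : K0sort_opp (cls x) = cls (K0opp x).
Proof. by apply: clsP; apply: K0eq_opp; apply: reprP. Qed.

Fact K0sort_addA : associative K0sort_add.
Proof.
move=> p q r; have [x ->] := ecls_surj p; have [y ->] := ecls_surj q.
have [z ->] := ecls_surj r; rewrite !K0sort_addE; apply: clsP; exact: K0eq_addA.
Qed.

Fact K0sort_addC : commutative K0sort_add.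
Proof.
move=> p q; have [x ->] := ecls_surj p; have [y ->] := ecls_surj q.
rewrite !K0sort_addE; apply: clsP; exact: K0eq_addC.
Qed.

Fact K0sort_add0 : left_id (cls K0zero) K0sort_add.
Proof.
move=> p; have [x ->] := ecls_surj p; rewrite K0sort_addE.
by apply: clsP; exact: K0eq_add0.
Qed.

Fact K0sort_addN : left_inverse (cls K0zero) K0sort_opp K0sort_add.
Proof.
move=> p; have [x ->] := ecls_surj p; rewrite K0sort_oppE K0sort_addE.
by apply: clsP; exact: K0eq_addN.
Qed.

Definition K0 : abGroup :=
  AbGroup K0sort_addA K0sort_addC K0sort_add0 K0sort_addN.

Definition K0class (A : X) : K0 := cls (K0gen A).

Lemma K0class_iso A B : iso A B -> K0class A = K0class B.
Proof. by move=> AB; apply: clsP; apply: K0eq_iso. Qed.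

Lemma K0class_ses A B C :
  ses A B C -> K0class B = (K0class A + K0class C)%AB.
Proof.
by move=> ABC; rewrite /= K0sort_addE; apply: clsP; apply: K0eq_ses.
Qed.

Lemma K0_ind (Pr : K0 -> Prop) :
    Pr ab0 -> (forall A, Pr (K0class A)) -> (forall x, Pr x -> Pr (- x)%AB) ->
    (forall x y, Pr x -> Pr y -> Pr (x + y)%AB) ->
  forall x, Pr x.
Proof.
move=> P0 Pg PN PD p; have [x ->] := ecls_surj p.
elim: x => [A||x IHx|x IHx y IHy].
- exact: Pg.
- exact: P0.
- by rewrite -K0sort_oppE; exact: PN.
- by rewrite -K0sort_addE; exact: PD.
Qed.

Lemma K0_lift_ex (G : abGroup) (g : X -> G) :
    (forall A B, iso A B -> g A = g B) ->
    (forall A B C, ses A B C -> g B = (g A + g C)%AB) ->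
  {h : abHom K0 G | forall A, h (K0class A) = g A}.
Proof.
move=> giso gses.
pose ev := fix ev w : G := match w with K0gen A => g A | K0zero => ab0
  | K0opp x => abopp (ev x) | K0add x y => abadd (ev x) (ev y) end.
have evE x y : K0eq x y -> ev x = ev y.
  elim=> {x y} /=.
  - by [].
  - by move=> x y _ ->.
  - by move=> x y z _ -> _ ->.
  - by move=> x x' _ ->.
  - by move=> x x' y y' _ -> _ ->.
  - by move=> *; rewrite abaddA.
  - by move=> *; rewrite abaddC.
  - by move=> *; rewrite abadd0.
  - by move=> *; rewrite abaddN.
  - exact: giso.
  - exact: gses.
have hE x : ev (erepr (cls x)) = ev x by apply: evE; exact: reprP.
have hD (p q : K0) :
    ev (erepr (p + q)%AB) = (ev (erepr p) + ev (erepr q))%AB.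
  have [x ->] := ecls_surj p; have [y ->] := ecls_surj q.
  by rewrite [X in erepr X]K0sort_addE !hE.
by exists (@AbHom K0 G (fun q => ev (erepr q)) hD) => A; exact: hE.
Qed.

Definition K0_lift (G : abGroup) (g : X -> G)
    (giso : forall A B, iso A B -> g A = g B)
    (gses : forall A B C, ses A B C -> g B = (g A + g C)%AB) : abHom K0 G :=
  sval (K0_lift_ex giso gses).

Lemma K0_liftE (G : abGroup) (g : X -> G) giso gses A :
  K0_lift (G := G) (g := g) giso gses (K0class A) = g A.
Proof. exact: (svalP (K0_lift_ex giso gses)). Qed.

End K0.

Definition finitely_generated (S : pzRingType) (P : rmodType S) : Prop :=
  exists (n : nat) (p : 'I_n -> P),
    forall x, exists s : 'I_n -> S, x = \sum_i p i :* s i.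

Definition projective (S : pzRingType) (P : rmodType S) : Prop :=
  forall (A B : rmodType S) (g : rlin A B) (h : rlin P B),
    (forall b, exists a, g a = b) -> exists k : rlin P A, forall x, g (k x) = h x.

(* Flatness of the right R-module M: M (x)_R - preserves injections of left
   R-modules. This is the side on which M is tensored in End(R, S; M, N). *)
Definition flat (R : pzRingType) (M : bimodType R R) : Prop :=
  forall (A B : lmodType R) (g : {linear A -> B}),
    injective g -> injective (tmap (rid M) g).

Record modc (R S : pzRingType) := Modc {
  mod_bim :> bimodType R S;
  mod_fg : finitely_generated mod_bim;
  mod_proj : projective mod_bim }.
Arguments mod_fg {R S} m.
Arguments mod_proj {R S} m.

Definition short_exact (R S : pzRingType) (U V W : bimodType R S)
    (i : bimHom U V) (p : bimHom V W) : Prop :=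
  [/\ injective i, forall v, p v = 0 <-> exists u, v = i u
    & forall w, exists v, p v = w].

Definition mod_iso (R S : pzRingType) (P Q : modc R S) : Prop :=
  exists (f : bimHom P Q) (g : bimHom Q P), cancel f g /\ cancel g f.

Definition mod_ses (R S : pzRingType) (P Q W : modc R S) : Prop :=
  exists (i : bimHom P Q) (p : bimHom Q W), short_exact i p.

Section EndCategory.
Variables (R S : pzRingType) (M : bimodType R R) (N : bimodType S S).

Record endobj := EndObj {
  eobj : modc R S;
  emap : bimHom (M *ox eobj) (eobj *ox N) }.

Record endmor (x y : endobj) := EndMor {
  mor_hom :> bimHom (eobj x) (eobj y);
  mor_comm : forall u,
    bmap mor_hom (bid N) (emap x u) = emap y (bmap (bid M) mor_hom u) }.

Definition end_iso (x y : endobj) : Prop :=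
  exists (f : endmor x y) (g : endmor y x), cancel f g /\ cancel g f.

Definition end_ses (x y z : endobj) : Prop :=
  exists (i : endmor x y) (p : endmor y z), short_exact i p.

Definition zero_end (P : modc R S) : endobj :=
  @EndObj P (bzero (M *ox P) (P *ox N)).

End EndCategory.

Section K0End.
Variables (R S : pzRingType) (M : bimodType R R) (N : bimodType S S).

Definition K0mod : abGroup := K0 (@mod_iso R S) (@mod_ses R S).
Definition K0end : abGroup := K0 (@end_iso R S M N) (@end_ses R S M N).

Definition zero_mor (P Q : modc R S) (f : bimHom P Q) :
    endmor (zero_end M N P) (zero_end M N Q) :=
  @EndMor R S M N (zero_end M N P) (zero_end M N Q) f
    (fun u => raddf0 (bmap f (bid N))).

Definition K0_zero : abHom K0mod K0end.
Proof.
apply: (K0_lift (g := fun P => K0class _ _ (zero_end M N P))).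
  move=> P Q [f [g [fK gK]]]; apply: K0class_iso.
  by exists (zero_mor f), (zero_mor g).
by move=> P Q W [i [p ip]]; apply: K0class_ses; exists (zero_mor i), (zero_mor p).
Defined.

Definition K0t : abGroup := coker K0_zero.

Definition K0tclass (x : endobj M N) : K0t := coker_pi K0_zero (K0class _ _ x).

Lemma K0tclass_iso x y : end_iso x y -> K0tclass x = K0tclass y.
Proof. by move=> xy; congr (coker_pi _ _); exact: K0class_iso. Qed.

Lemma K0tclass_ses x y z :
  end_ses x y z -> K0tclass y = (K0tclass x + K0tclass z)%AB.
Proof.
by move=> xyz; rewrite /K0tclass -abhomD; congr (coker_pi _ _); exact: K0class_ses.
Qed.

Lemma K0tclass0 x : (forall u, emap x u = 0) -> K0tclass x = ab0.
Proof.
move=> x0; rewrite -(coker_pi0 K0_zero (K0class _ _ (eobj x))).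
rewrite /K0_zero K0_liftE; apply: K0tclass_iso.
have h u : bmap (bid _) (bid N) (emap x u) =
    emap (zero_end M N (eobj x)) (bmap (bid M) (bid _) u).
  by rewrite x0 raddf0.
have k u : bmap (bid _) (bid N) (emap (zero_end M N (eobj x)) u) =
    emap x (bmap (bid M) (bid _) u).
  by rewrite x0 raddf0.
by exists (@EndMor R S M N x (zero_end M N (eobj x)) (bid _) h),
  (@EndMor R S M N (zero_end M N (eobj x)) x (bid _) k).
Qed.

Lemma K0t_ind (Pr : K0t -> Prop) :
    Pr ab0 -> (forall x, Pr (K0tclass x)) -> (forall x, Pr x -> Pr (- x)%AB) ->
    (forall x y, Pr x -> Pr y -> Pr (x + y)%AB) ->
  forall x, Pr x.
Proof.
move=> P0 Pg PN PD q; have [x ->] := coker_pi_surj q.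
move: x; apply: K0_ind => [|x|x Px|x y Px Py].
- by rewrite abhom0.
- exact: Pg.
- by rewrite abhomN; exact: PN.
- by rewrite abhomD; exact: PD.
Qed.

Section Lift.
Variables (G : abGroup) (g : endobj M N -> G).
Hypotheses (giso : forall x y, end_iso x y -> g x = g y)
  (gses : forall x y z, end_ses x y z -> g y = (g x + g z)%AB)
  (g0 : forall P, g (zero_end M N P) = ab0).

Let K0_lift_zero a : K0_lift giso gses (K0_zero a) = ab0.
Proof.
move: a; apply: K0_ind => [|P|a Ha|a b Ha Hb].
- by rewrite !abhom0.
- by rewrite /K0_zero !K0_liftE.
- by rewrite !abhomN Ha abopp0.
- by rewrite !abhomD Ha Hb abadd0.
Qed.

Definition K0t_lift : abHom K0t G := coker_lift K0_lift_zero.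

Lemma K0t_liftE x : K0t_lift (K0tclass x) = g x.
Proof. by rewrite /K0t_lift /K0tclass coker_liftE K0_liftE. Qed.

Lemma K0t_ext (h k : abHom K0t G) :
  (forall x, h (K0tclass x) = k (K0tclass x)) -> h =1 k.
Proof.
move=> hk; apply: K0t_ind => [//|||x y]; rewrite ?abhom0 //.
  by move=> x; rewrite !abhomN => ->.
by rewrite !abhomD => -> ->.
Qed.

End Lift.
End K0End.

Section BmapTheory.
Variables (R S T : pzRingType).

Lemma eq_bmap (P P' : bimodType R S) (Q Q' : bimodType S T)
    (f f' : bimHom P P') (g g' : bimHom Q Q') :
  f =1 f' -> g =1 g' -> bmap f g =1 bmap f' g'.
Proof. by move=> ff gg; apply: bim_ext => p q; rewrite !bmapE ff gg. Qed.

Lemma bmap_comp (P P' P'' : bimodType R S) (Q Q' Q'' : bimodType S T)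
    (f : bimHom P P') (f' : bimHom P' P'')
    (g : bimHom Q Q') (g' : bimHom Q' Q'') x :
  bmap f' g' (bmap f g x) = bmap (bcomp f' f) (bcomp g' g) x.
Proof.
rewrite -[LHS]/(bcomp (bmap f' g') (bmap f g) x).
by move: x; apply: bim_ext => p q; rewrite /= !bmapE.
Qed.

Lemma bmap_id (P : bimodType R S) (Q : bimodType S T) x :
  bmap (bid P) (bid Q) x = x.
Proof.
rewrite -[RHS]/(bid _ x).
by move: x; apply: bim_ext => p q; rewrite /= !bmapE.
Qed.

Lemma bmap0l (P P' : bimodType R S) (Q Q' : bimodType S T)
    (f : bimHom P P') (g : bimHom Q Q') x :
  (forall p, f p = 0) -> bmap f g x = 0.
Proof.
move=> f0; rewrite -[RHS]/(bzero (P *ox Q) (P' *ox Q') x).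
by move: x; apply: bim_ext => p q; rewrite bmapE f0 tpure0l.
Qed.

End BmapTheory.

Lemma assoc_nat (R S T U : pzRingType) (P P' : bimodType R S)
    (Q Q' : bimodType S T) (W W' : bimodType T U)
    (f : bimHom P P') (g : bimHom Q Q') (h : bimHom W W') x :
  assoc P' Q' W' (bmap (bmap f g) h x) = bmap f (bmap g h) (assoc P Q W x).
Proof.
move: x; apply: (@tensor3_extl R S T U P Q W _
  (assoc P' Q' W' \o bmap (bmap f g) h) (bmap f (bmap g h) \o assoc P Q W)).
by move=> p q w; rewrite /= assocE !bmapE assocE.
Qed.

Lemma assocV_nat (R S T U : pzRingType) (P P' : bimodType R S)
    (Q Q' : bimodType S T) (W W' : bimodType T U)
    (f : bimHom P P') (g : bimHom Q Q') (h : bimHom W W') x :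
  bfrom (assoc P' Q' W') (bmap f (bmap g h) x)
  = bmap (bmap f g) h (bfrom (assoc P Q W) x).
Proof. by rewrite -{1}[x](bfromK (assoc P Q W)) -assoc_nat btoK. Qed.

Section Transport.
Variables (R S : pzRingType) (M M' : bimodType R R) (N N' : bimodType S S).
Variables (a : bimIso M M') (b : bimIso N N').

(* f : M (x) P -> P (x) N  becomes  (id (x) b) f (a^-1 (x) id). *)
Definition transport_end (x : endobj M N) : endobj M' N' :=
  @EndObj R S M' N' (eobj x)
    (bcomp (bmap (bid (eobj x)) b) (bcomp (emap x) (bmap (bfrom a) (bid (eobj x))))).

Definition transport_mor (x y : endobj M N) (f : endmor x y) :
  endmor (transport_end x) (transport_end y).
Proof.
refine (@EndMor R S M' N' (transport_end x) (transport_end y) f _) => u /=.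
rewrite bmap_comp; transitivity (bmap (bid _) b (bmap f (bid N)
  (emap x (bmap (bfrom a) (bid _) u)))); first by rewrite bmap_comp; exact: eq_bmap.
rewrite mor_comm !bmap_comp; congr (bmap _ _ (emap _ _)); exact: eq_bmap.
Defined.

Definition K0t_transport : abHom (K0t M N) (K0t M' N').
Proof.
apply: (K0t_lift (g := fun x => K0tclass (transport_end x))).
- move=> x y [f [g [fK gK]]]; apply: K0tclass_iso.
  by exists (transport_mor f), (transport_mor g).
- move=> x y z [i [p ip]]; apply: K0tclass_ses.
  by exists (transport_mor i), (transport_mor p).
- by move=> P; apply: K0tclass0 => u; rewrite /= raddf0.
Defined.

Lemma K0t_transportE x : K0t_transport (K0tclass x) = K0tclass (transport_end x).
Proof. exact: K0t_liftE. Qed.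

End Transport.

Section Gamma.
Variables (R S : pzRingType) (M : bimodType R R) (N : bimodType S S).

(* gamma f n is Gamma(f, ..., f) with n copies of f, for n >= 1; the value f at
   n = 0 is a dummy, as for tpow. Splitting off the last factor applied,
   Gamma_(n+1) = (f (x) id_(N^n)) (id_M (x) Gamma_n), up to reassociation. *)
Fixpoint gamma (P : bimodType R S) (f : bimHom (M *ox P) (P *ox N)) (n : nat) :
    bimHom (tpow M n *ox P) (P *ox tpow N n) :=
  match n with
  | 0 => f
  | n'.+1 =>
    (match n' as k return bimHom (tpow M k *ox P) (P *ox tpow N k) ->
                          bimHom (tpow M k.+1 *ox P) (P *ox tpow N k.+1) with
     | 0 => fun _ => f
     | k'.+1 => fun g =>
       bcomp (assoc P N (tpow N k'.+1))
      (bcomp (bmap f (bid (tpow N k'.+1)))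
      (bcomp (bfrom (assoc M P (tpow N k'.+1)))
      (bcomp (bmap (bid M) g)
             (assoc M (tpow M k'.+1) P))))
     end) (gamma f n')
  end.

Definition gamma_end (n : nat) (x : endobj M N) : endobj (tpow M n) (tpow N n) :=
  @EndObj R S (tpow M n) (tpow N n) (eobj x) (gamma (emap x) n).

Lemma gammaSS (P : bimodType R S) (f : bimHom (M *ox P) (P *ox N)) n u :
  gamma f n.+2 u = assoc P N (tpow N n.+1) (bmap f (bid (tpow N n.+1))
    (bfrom (assoc M P (tpow N n.+1)) (bmap (bid M) (gamma f n.+1)
      (assoc M (tpow M n.+1) P u)))).
Proof. by []. Qed.

Lemma gamma_nat (x y : endobj M N) (f : endmor x y) n u :
  bmap f (bid (tpow N n)) (gamma (emap x) n u)
  = gamma (emap y) n (bmap (bid (tpow M n)) f u).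
Proof.
elim: n u => [|[|n] IHn] u; [exact: mor_comm | exact: mor_comm |].
rewrite !gammaSS.
have idE (A B : bimodType S S) : bid (A *ox B) =1 bmap (bid A) (bid B).
  by move=> v; rewrite bmap_id.
have idE' (A B : bimodType R R) : bid (A *ox B) =1 bmap (bid A) (bid B).
  by move=> v; rewrite bmap_id.
rewrite [LHS](eq_bmap (f' := f) _ (idE N (tpow N n.+1))) //.
rewrite -assoc_nat; congr (assoc _ _ _ _).
rewrite bmap_comp.
rewrite (eq_bmap (f' := bcomp (emap y) (bmap (bid M) f)) (g' := bcomp (bid _) (bid _))); last 2 first.
- exact: mor_comm.
- by [].
rewrite -bmap_comp; congr (bmap _ _ _).
rewrite -assocV_nat; congr (bfrom _ _).
rewrite bmap_comp.
rewrite (eq_bmap (f' := bcomp (bid M) (bid M))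
  (g' := bcomp (gamma (emap y) n.+1) (bmap (bid (tpow M n.+1)) f))); last 2 first.
- by [].
- exact: IHn.
rewrite -bmap_comp; congr (bmap _ _ _).
rewrite -assoc_nat; congr (assoc _ _ _ _).
by apply: eq_bmap => // v; rewrite bmap_id.
Qed.

Definition gamma_mor n (x y : endobj M N) (f : endmor x y) :
    endmor (gamma_end n x) (gamma_end n y) :=
  @EndMor R S _ _ (gamma_end n x) (gamma_end n y) f (gamma_nat f (n := n)).

Lemma gamma0 (P : modc R S) n u : gamma (emap (zero_end M N P)) n u = 0.
Proof.
case: n u => [|[|n]] u //=.
by rewrite bmap0l ?raddf0.
Qed.

Definition frob (n : nat) : abHom (K0t M N) (K0t (tpow M n) (tpow N n)).
Proof.
apply: (K0t_lift (g := fun x => K0tclass (gamma_end n x))).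
- move=> x y [f [g [fK gK]]]; apply: K0tclass_iso.
  by exists (gamma_mor n f), (gamma_mor n g).
- move=> x y z [i [p ip]]; apply: K0tclass_ses.
  by exists (gamma_mor n i), (gamma_mor n p).
- by move=> P; apply: K0tclass0 => u; exact: gamma0.
Defined.

Lemma frobE n x : frob n (K0tclass x) = K0tclass (gamma_end n x).
Proof. exact: K0t_liftE. Qed.

End Gamma.

Record dual_basis (S : pzRingType) (P : rmodType S) := DualBasis {
  db_size : nat;
  db_vec : 'I_db_size -> P;
  db_cov : 'I_db_size -> rlin P S^o;
  db_sum : forall x, x = \sum_i db_vec i :* db_cov i x }.
Arguments db_vec {S P} d i.
Arguments db_cov {S P} d i.
Arguments db_sum {S P} d x.

Section DualBasis.
Variable S : pzRingType.

Definition free_rmod (n : nat) : Type := {ffun 'I_n -> S}.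
HB.instance Definition _ n := GRing.Zmodule.on (free_rmod n).

Section FreeInstance.
Variable n : nat.
Definition free_ract (v : free_rmod n) (s : S) : free_rmod n := [ffun i => v i * s].
Fact free_ractA v s t : free_ract (free_ract v s) t = free_ract v (s * t).
Proof. by apply/ffunP => i; rewrite !ffunE mulrA. Qed.
Fact free_ract1 v : free_ract v 1 = v.
Proof. by apply/ffunP => i; rewrite !ffunE mulr1. Qed.
Fact free_ractDl u v s : free_ract (u + v) s = free_ract u s + free_ract v s.
Proof. by apply/ffunP => i; rewrite !ffunE mulrDl. Qed.
Fact free_ractDr v s t : free_ract v (s + t) = free_ract v s + free_ract v t.
Proof. by apply/ffunP => i; rewrite !ffunE mulrDr. Qed.
HB.instance Definition _ := Zmodule_isRmodule.Build S (free_rmod n)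
  free_ractA free_ract1 free_ractDl free_ractDr.
End FreeInstance.

Lemma ract0l (P : rmodType S) s : (0 : P) :* s = 0.
Proof. by apply: (addrI ((0 : P) :* s)); rewrite -ractDl !addr0. Qed.

Lemma ract0r (P : rmodType S) (p : P) : p :* 0 = 0.
Proof. by apply: (addrI (p :* 0)); rewrite -ractDr !addr0. Qed.

Lemma ractBl (P : rmodType S) (u v : P) s : (u - v) :* s = u :* s - v :* s.
Proof. by apply: (addIr (v :* s)); rewrite subrK -ractDl subrK. Qed.

Lemma ract_suml (P : rmodType S) I (r : seq I) (F : I -> P) s :
  (\sum_(i <- r) F i) :* s = \sum_(i <- r) F i :* s.
Proof. exact: (big_morph (fun p => p :* s) (fun p q => ractDl p q s) (ract0l P s)). Qed.

Lemma mk_rlin (U V : rmodType S) (f : U -> V) :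
    (forall x y, f (x + y) = f x + f y) -> (forall x s, f (x :* s) = f x :* s) ->
  {g : rlin U V | g =1 f}.
Proof.
move=> fD fZ.
have fB : zmod_morphism f.
  by move=> x y; apply: (addIr (f y)); rewrite subrK -fD subrK.
by exists (@Rlin S U V (HB.pack_for {additive U -> V} f
  (GRing.isZmodMorphism.Build U V f fB)) fZ).
Qed.

Lemma dual_basis_ex (P : rmodType S) :
  finitely_generated P -> projective P -> exists b : dual_basis P, True.
Proof.
move=> [n [p pgen]] Pproj.
have [g gE] : {g : rlin (free_rmod n) P |
    g =1 fun v => \sum_i p i :* (v : {ffun 'I_n -> S}) i}.
  apply: mk_rlin => [u v|u s].
    by rewrite -big_split /=; apply: eq_bigr => i _; rewrite ffunE ractDr.
  by rewrite ract_suml; apply: eq_bigr => i _; rewrite ffunE ractA.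
have gsurj x : exists v, g v = x.
  by have [s ->] := pgen x; exists [ffun i => s i]; rewrite gE;
    apply: eq_bigr => i _; rewrite ffunE.
have [k gk] := Pproj _ _ g (rid P) gsurj.
have cov i : {c : rlin P S^o | c =1 fun x => (k x : {ffun 'I_n -> S}) i}.
  by apply: mk_rlin => [x y|x s]; [rewrite raddfD ffunE | rewrite rlinZ ffunE].
have bP x : x = \sum_i p i :* sval (cov i) x; last by exists (DualBasis bP).
have -> : x = g (k x) by rewrite gk.
rewrite gE; apply: eq_bigr => i _; congr (_ :* _); rewrite (svalP (cov i)).
by rewrite -gE gk.
Qed.

End DualBasis.

Definition the_dual_basis (R S : pzRingType) (P : modc R S) : dual_basis P :=
  sval (cid (dual_basis_ex (mod_fg P) (mod_proj P))).

Inductive shadow_rel (R : pzRingType) (M : bimodType R R) : M -> Prop :=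
| ShadowRel r m : shadow_rel (r *: m - m :* r).

Definition shadow (R : pzRingType) (M : bimodType R R) : zmodType :=
  zquot (@shadow_rel R M).

Definition sh (R : pzRingType) (M : bimodType R R) (m : M) : shadow M :=
  zpi (@shadow_rel R M) m.

Lemma sh_is_additive (R : pzRingType) (M : bimodType R R) : zmod_morphism (@sh R M).
Proof. by move=> x y; rewrite /sh raddfB. Qed.
HB.instance Definition _ (R : pzRingType) (M : bimodType R R) :=
  GRing.isZmodMorphism.Build M (shadow M) (@sh R M) (@sh_is_additive R M).

Lemma sh_comm (R : pzRingType) (M : bimodType R R) r (m : M) : sh (r *: m) = sh (m :* r).
Proof. exact: (zpi_eq (ShadowRel r m)). Qed.

Section Shadow.
Variables (R : pzRingType) (M M' : bimodType R R).

Lemma shadow_map_kill (f : bimHom M M') (x : M) :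
  shadow_rel x -> ((@sh R M') \o f) x = 0.
Proof.
by case=> r m; rewrite /= linearB linearZ bhomZr raddfB /= sh_comm subrr.
Qed.

Definition shadow_map (f : bimHom M M') : {additive shadow M -> shadow M'} :=
  zlift (shadow_map_kill f).

Lemma shadow_mapE f m : shadow_map f (sh m) = sh (f m).
Proof. exact: zliftE. Qed.

End Shadow.

Definition homg_fun (A B : zmodType) (f : homg A B) : {additive A -> B} := f.

Section Unitor.
Variables (S T : pzRingType) (N : bimodType S T).

Program Definition lunit_bal : balanced S^o N N :=
  @Balanced S S^o N N (fun s n => (s : S) *: n) _ _ _.
Next Obligation. exact: scalerDl. Qed.
Next Obligation. exact: scalerDr. Qed.
Next Obligation. by rewrite -scalerA. Qed.

(* The isomorphism S (x)_S N = N. *)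
Definition lunit : {additive tensor S^o N -> N} := tlift lunit_bal.

Variables (P : rmodType S) (c : rlin P S^o).

(* c (x) id_N : P (x)_S N -> S (x)_S N = N. *)
Definition contract (x : tensor P N) : N := lunit (tmap c idfun x).

Lemma contract_is_additive : zmod_morphism contract.
Proof. by move=> x y; rewrite /contract !raddfB. Qed.
HB.instance Definition _ :=
  GRing.isZmodMorphism.Build (tensor P N) N contract contract_is_additive.

Lemma contractE p n : contract (p *t n) = (c p : S) *: n.
Proof. by rewrite /contract tmapE /lunit tliftE. Qed.

End Unitor.

Section ContractTheory.
Variables (R S : pzRingType).

Lemma contractZr (P : rmodType S) (N : bimodType S S) (c : rlin P S^o)
    (x : tensor P N) s :
  contract c (x :* s) = contract c x :* s.
Proof.
rewrite -[LHS]/((contract c \o tmap (rid P) (rmul N s)) x).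
rewrite -[RHS]/((rmul N s \o contract c) x).
move: x; apply: tensor_ext => p n.
by rewrite /= tmapE !contractE /= scale_ractA.
Qed.

(* x = \sum_i p_i (x) (p_i^* (x) id) x in P (x) N. *)
Lemma db_contract (P : rmodType S) (N : bimodType S S) (b : dual_basis P)
    (x : tensor P N) :
  x = \sum_i db_vec b i *t contract (db_cov b i) x.
Proof.
have FB i : zmod_morphism
    (fun x : tensor P N => db_vec b i *t contract (db_cov b i) x).
  move=> u v; apply: (addIr (db_vec b i *t contract (db_cov b i) v)).
  by rewrite subrK -tpureDr -raddfD subrK.
pose F i : {additive tensor P N -> tensor P N} := HB.pack_for
  {additive tensor P N -> tensor P N}
  (fun x : tensor P N => db_vec b i *t contract (db_cov b i) x)
  (GRing.isZmodMorphism.Build _ _ _ (FB i)).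
have GB : zmod_morphism (fun x : tensor P N => \sum_i F i x).
  by move=> u v; rewrite -sumrB; apply: eq_bigr => i _; rewrite raddfB.
pose G : {additive tensor P N -> tensor P N} := HB.pack_for
  {additive tensor P N -> tensor P N} (fun x : tensor P N => \sum_i F i x)
  (GRing.isZmodMorphism.Build _ _ _ GB).
suff : idfun =1 G by apply.
apply: tensor_ext => p n; rewrite /= {1}[p](db_sum b) tpure_suml.
by apply: eq_bigr => i _; rewrite tpureM contractE.
Qed.

End ContractTheory.

Section Trace.
Variables (R S : pzRingType) (M : bimodType R R) (N : bimodType S S).

Section TraceOn.
Variables (P : bimodType R S) (f : bimHom (M *ox P) (P *ox N)).

(* The class of \sum_i (p_i^* (x) id)(f (m (x) p_i)). *)
Definition trace_fun (b : dual_basis P) (m : M) : shadow N :=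
  \sum_i sh (contract (db_cov b i) (f (m *t db_vec b i))).

(* Cyclicity with respect to right linear maps P' -> P -> P'. *)
Lemma trace_cyclic (b : dual_basis P) (P' : rmodType S) (b' : dual_basis P')
    (u : rlin P' P) (v : rlin P P') (m : M) :
  \sum_k sh (contract (db_cov b k) (f (m *t u (v (db_vec b k))))) =
  \sum_l sh (contract (db_cov b' l) (tmap v idfun (f (m *t u (db_vec b' l))))).
Proof.
transitivity (\sum_k \sum_l sh ((db_cov b' l (v (db_vec b k)) : S)
    *: contract (db_cov b k) (f (m *t u (db_vec b' l))))).
  apply: eq_bigr => k _.
  rewrite {1}[v _](db_sum b') (raddf_sum u) tpure_sumr !raddf_sum /=.
  apply: eq_bigr => l _.
  by rewrite rlinZ -tpureZr bhomZr contractZr sh_comm.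
rewrite exchange_big; apply: eq_bigr => l _ /=.
rewrite [in RHS](db_contract b (f _)) !raddf_sum /=; apply: eq_bigr => k _.
by rewrite tmapE contractE.
Qed.

Lemma trace_fun_basis (b c : dual_basis P) m : trace_fun b m = trace_fun c m.
Proof.
rewrite /trace_fun (trace_cyclic b c (rid P) (rid P)); apply: eq_bigr => l _.
by congr (sh (contract _ _)); rewrite /=; move: (f _); apply: (@tensor_ext S P N _ (tmap (rid P) idfun) idfun) => p n; exact: tmapE.
Qed.

Variable b : dual_basis P.

Lemma trace_fun_is_additive : zmod_morphism (trace_fun b).
Proof.
move=> m m'; apply: (addIr (trace_fun b m')); rewrite subrK -big_split /=.
by apply: eq_bigr => i _; rewrite -{2}[m](subrK m') [in RHS]tpureDl !raddfD.
Qed.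
HB.instance Definition _ :=
  GRing.isZmodMorphism.Build M (shadow N) (trace_fun b) trace_fun_is_additive.

Lemma trace_fun_comm (x : M) : shadow_rel x -> trace_fun b x = 0.
Proof.
case=> r m; rewrite raddfB /=; apply/eqP; rewrite subr_eq0; apply/eqP.
have := trace_cyclic b b (rid P) (lmul P r) m; rewrite /= => E.
transitivity (\sum_l sh (contract (db_cov b l)
    (tmap (lmul P r) idfun (f (m *t db_vec b l))))).
  apply: eq_bigr => l _; congr (sh (contract _ _)).
  by rewrite -tpureZl linearZ.
by rewrite -E; apply: eq_bigr => k _; rewrite tpureM.
Qed.

Definition trace : {additive shadow M -> shadow N} := zlift trace_fun_comm.

Lemma traceE m : trace (sh m) = trace_fun b m.
Proof. exact: zliftE. Qed.

End TraceOn.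

(* The trace of an object of End(R, S; M, N), for any choice of dual basis. *)
Definition trace_end (x : endobj M N) : homg (shadow M) (shadow N) :=
  trace (emap x) (the_dual_basis (eobj x)).

Lemma trace_endE (x : endobj M N) (b : dual_basis (eobj x)) :
  trace_end x = trace (emap x) b.
Proof.
apply: additive_eq; apply: zquot_ext => m.
by rewrite /trace_end -/(sh m) !traceE; exact: trace_fun_basis.
Qed.

Lemma tmap_mor (x y : endobj M N) (h : endmor x y) (m : M) (p : eobj x) :
  tmap h idfun (emap x (m *t p)) = emap y (m *t h p) :> tensor _ _.
Proof.
transitivity (bmap h (bid N) (emap x (m *t p))); last first.
  by rewrite mor_comm; congr (emap y _); exact: bmapE.
move: (emap x _); apply: (@tensor_ext S (eobj x) N _ (tmap h idfun) (bmap h (bid N))).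
by move=> q n; rewrite tmapE; exact: (esym (bmapE h (bid N) q n)).
Qed.

Lemma trace_end_iso (x y : endobj M N) : end_iso x y -> trace_end x = trace_end y.
Proof.
move=> [h [k [hK kK]]]; apply: additive_eq; apply: zquot_ext => m.
rewrite -/(sh m) !traceE /trace_fun.
have := trace_cyclic (emap x) (the_dual_basis (eobj x)) (the_dual_basis (eobj y)) k h m.
move=> E; transitivity (\sum_i sh (contract (db_cov (the_dual_basis (eobj x)) i)
    (emap x (m *t k (h (db_vec (the_dual_basis (eobj x)) i)))))).
  by apply: eq_bigr => i _; rewrite hK.
rewrite {}E; apply: eq_bigr => i _; congr (sh (contract _ _)).
by etransitivity; [exact: (tmap_mor h m (k _)) | rewrite kK].
Qed.

Lemma trace_end_ses (x y z : endobj M N) :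
  end_ses x y z -> trace_end y = (trace_end x + trace_end z)%AB.
Proof.
move=> [i [p [iI kerp psurj]]]; apply: additive_eq; apply: zquot_ext => m.
rewrite /= -/(sh m) !traceE /trace_fun.
have [s ps] := mod_proj (eobj z) _ _ p (rid (eobj z)) psurj.
have [r ri] : {r : rlin (eobj y) (eobj x) | forall v, i (r v) = v - s (p v)}.
  have ex v : exists u, v - s (p v) = i u.
    by apply/kerp; rewrite raddfB /=; move: (ps (p v)) => /= ->; rewrite subrr.
  pose r0 v := sval (cid (ex v)).
  have r0E v : i (r0 v) = v - s (p v) by rewrite /r0; case: cid.
  have [r rE] : {r : rlin (eobj y) (eobj x) | r =1 r0}.
    apply: mk_rlin => [v w|v t]; apply: iI.
      by rewrite linearD /= !r0E linearD raddfD opprD addrACA.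
    by rewrite bhomZr !r0E bhomZr rlinZ ractBl.
  by exists r => v; rewrite rE.
have ir u : r (i u) = u.
  apply: iI; rewrite ri; have -> : p (i u) = 0 by apply/kerp; exists u.
  by rewrite raddf0 subr0.
pose b (v : endobj M N) := the_dual_basis (eobj v).
have Ex := trace_cyclic (emap y) (b y) (b x) i r m.
have Ez := trace_cyclic (emap y) (b y) (b z) s p m.
transitivity (\sum_k sh (contract (db_cov (b y) k)
                (emap y (m *t i (r (db_vec (b y) k))))) +
              \sum_k sh (contract (db_cov (b y) k)
                (emap y (m *t s (p (db_vec (b y) k)))))).
  rewrite -big_split /=; apply: eq_bigr => k _; rewrite ri.
  rewrite -{1}[db_vec (b y) k](subrK (s (p (db_vec (b y) k)))).
  by rewrite [in LHS]tpureDr !raddfD.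
congr (_ + _); rewrite /= in Ex Ez *.
  rewrite Ex; apply: eq_bigr => k _; congr (sh (contract _ _)).
  etransitivity; first exact: (congr1 (tmap r idfun) (esym (tmap_mor i m _))).
  rewrite -[LHS]/((tmap r idfun \o tmap i idfun) (emap x (m *t db_vec (b x) k))).
  move: (emap x _); apply: (@tensor_ext S (eobj x) N _ (tmap r idfun \o tmap i idfun) idfun).
  by move=> q n; rewrite /= !tmapE /= ir.
rewrite Ez; apply: eq_bigr => k _; congr (sh (contract _ _)).
etransitivity; first exact: (tmap_mor p m (s _)).
by congr (emap z (m *t _)); exact: ps.
Qed.

Lemma trace_end0 (P : modc R S) : trace_end (zero_end M N P) = ab0.
Proof.
apply: additive_eq; apply: zquot_ext => m; rewrite -/(sh m) traceE /=.
by rewrite /trace_fun big1 // => i _; rewrite !raddf0.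
Qed.

Definition tr : abHom (K0t M N) (homg (shadow M) (shadow N)) :=
  K0t_lift trace_end_iso trace_end_ses trace_end0.

Lemma trE x : tr (K0tclass x) = trace_end x.
Proof. exact: K0t_liftE. Qed.

End Trace.

(* The i-th component of the iterated trace map, for i >= 1. *)
Definition trace_iter (R S : pzRingType) (M : bimodType R R) (N : bimodType S S)
    (phi : K0t M N) (i : nat) : homg (shadow (tpow M i)) (shadow (tpow N i)) :=
  tr (tpow M i) (tpow N i) (frob M N i phi).

(* Main.v *)
From mathcomp Require Import all_boot all_algebra.
Require Import Defs.

Set Implicit Arguments.
Unset Strict Implicit.
Unset Printing Implicit Defensive.

Import GRing.Theory.
Local Open Scope ring_scope.

(** The two assertions of substance both come from one fact about
    endomorphisms: removing the parentheses from tensor powers turns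
    Gamma(Gamma(f, ..., f), ..., Gamma(f, ..., f)), with n blocks of m copies,
    into Gamma(f, ..., f) with nm copies ([gamma_mul]).

    To prove it, Gamma(f, ..., f) is viewed as an iterated binary product
    Gamma(f, g) = (f (x) id)(id (x) g) : M (x) M' (x) P -> P (x) N (x) N'
    ([gamma2]), and the bookkeeping of parentheses is expressed by the relation
    [intertwines a b f f'], which says that a : M -> M' and b : N -> N' carry
    f to f'. This relation is closed under composition of the pairs (a, b)
    ([intertwines_comp]), is compatible with the binary product
    ([intertwines_gamma2]), and the associativity isomorphisms intertwine
    Gamma(Gamma(f, g), h) with Gamma(f, Gamma(g, h)) ([intertwines_assoc]);
    in the last case both sides apply h, then g, then f, each to its own factor.
    Since the isomorphisms M^a (x) M^b = M^(a+b) and (M^m)^n = M^(nm) are built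
    from associativity isomorphisms by composition and tensoring, two
    inductions give [gamma_add] and [gamma_mul].

    Consequently F^n F^m and F^(nm) agree on the generators of the reduced K_0,
    hence everywhere, since all the maps involved are additive. For the iterated
    trace, the trace is natural in the pair (M, N) ([tr_transport]): a dual
    basis involves P only, and contracting against a covector of P commutes
    with maps of N. Transporting tr(F^i(F^n(phi))) along (M^n)^i = M^(in) and
    (N^n)^i = N^(in) therefore yields tr(F^(in)(phi)) by the identity
    F^i F^n = F^(in). *)

Section TensorSubtraction.
Variables (S : pzRingType) (P : rmodType S) (Q : lmodType S).

Lemma tpureBl (p p' : P) (q : Q) : (p - p') *t q = p *t q - p' *t q.
Proof. by apply: (addIr (p' *t q)); rewrite subrK -tpureDl subrK. Qed.

Lemma tpureBr (p : P) (q q' : Q) : p *t (q - q') = p *t q - p *t q'.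
Proof. by apply: (addIr (p *t q')); rewrite subrK -tpureDr subrK. Qed.

End TensorSubtraction.

Section Intertwining.
Variables (R S : pzRingType) (P : bimodType R S).

Definition intertwines (M M' : bimodType R R) (N N' : bimodType S S)
    (a : bimHom M M') (b : bimHom N N')
    (f : bimHom (M *ox P) (P *ox N)) (f' : bimHom (M' *ox P) (P *ox N')) :=
  forall u : M *ox P, bmap (bid P) b (f u) = f' (bmap a (bid P) u).

Lemma intertwines_id (M : bimodType R R) (N : bimodType S S)
    (f : bimHom (M *ox P) (P *ox N)) :
  intertwines (bid M) (bid N) f f.
Proof. move=> u; by rewrite !bmap_id. Qed.

Lemma intertwines_comp (M M' M'' : bimodType R R) (N N' N'' : bimodType S S)
    (a : bimHom M M') (a' : bimHom M' M'')
    (b : bimHom N N') (b' : bimHom N' N'')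
    (f : bimHom (M *ox P) (P *ox N)) (f' : bimHom (M' *ox P) (P *ox N'))
    (f'' : bimHom (M'' *ox P) (P *ox N'')) :
  intertwines a' b' f' f'' -> intertwines a b f f' ->
  intertwines (bcomp a' a) (bcomp b' b) f f''.
Proof.
move=> H' H u.
transitivity (bmap (bid P) b' (bmap (bid P) b (f u))).
  by rewrite bmap_comp; apply: eq_bmap.
by rewrite H H' bmap_comp; congr (f'' _); apply: eq_bmap.
Qed.

(** The pairing Gamma(f, g). The fixpoint [gamma] satisfies
    [gamma f n.+2 = gamma2 f (gamma f n.+1)] by conversion, which lets the
    inductions below reason about [gamma2] alone. *)
Definition gamma2 (M M' : bimodType R R) (N N' : bimodType S S)
    (f : bimHom (M *ox P) (P *ox N)) (g : bimHom (M' *ox P) (P *ox N')) :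
    bimHom ((M *ox M') *ox P) (P *ox (N *ox N')) :=
  bcomp (assoc P N N')
 (bcomp (bmap f (bid N'))
 (bcomp (bfrom (assoc M P N'))
 (bcomp (bmap (bid M) g) (assoc M M' P)))).

Lemma gamma2E (M M' : bimodType R R) (N N' : bimodType S S)
    (f : bimHom (M *ox P) (P *ox N)) (g : bimHom (M' *ox P) (P *ox N')) m m' p :
  gamma2 f g ((m *t m') *t p) =
  assoc P N N' (bmap f (bid N') (bfrom (assoc M P N') (m *t g (m' *t p)))).
Proof. by rewrite /= assocE bmapE. Qed.

(** The associativity isomorphisms are natural, so a and b can be moved past
    each factor of Gamma(f, g) in turn. *)
Lemma intertwines_gamma2 (M1 M1' M2 M2' : bimodType R R)
    (N1 N1' N2 N2' : bimodType S S)
    (a1 : bimHom M1 M1') (a2 : bimHom M2 M2')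
    (b1 : bimHom N1 N1') (b2 : bimHom N2 N2')
    (f : bimHom (M1 *ox P) (P *ox N1)) (f' : bimHom (M1' *ox P) (P *ox N1'))
    (g : bimHom (M2 *ox P) (P *ox N2)) (g' : bimHom (M2' *ox P) (P *ox N2')) :
  intertwines a1 b1 f f' -> intertwines a2 b2 g g' ->
  intertwines (bmap a1 a2) (bmap b1 b2) (gamma2 f g) (gamma2 f' g').
Proof.
move=> Hf Hg u; rewrite /= assoc_nat -assoc_nat; congr (assoc _ _ _ _).
transitivity (bmap f' (bid N2') (bmap (bmap a1 (bid P)) b2
  (bfrom (assoc M1 P N2) (bmap (bid M1) g (assoc M1 M2 P u))))).
  by rewrite !bmap_comp; apply: eq_bmap => // v; exact: Hf.
rewrite -assocV_nat; congr (bmap _ _ (bfrom _ _)).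
by rewrite !bmap_comp; apply: eq_bmap => // v; exact: Hg.
Qed.

(** The pentagon identity is avoided by evaluating on pure tensors: on
    ((m1 (x) m2) (x) m3) (x) p both sides compute h(m3 (x) p), apply g to m2 and
    the component in P of the result, then f to m1 and the component in P of
    that. *)
Lemma intertwines_assoc (M1 M2 M3 : bimodType R R) (N1 N2 N3 : bimodType S S)
    (f : bimHom (M1 *ox P) (P *ox N1)) (g : bimHom (M2 *ox P) (P *ox N2))
    (h : bimHom (M3 *ox P) (P *ox N3)) :
  intertwines (assoc M1 M2 M3) (assoc N1 N2 N3)
    (gamma2 (gamma2 f g) h) (gamma2 f (gamma2 g h)).
Proof.
have tB := (tpureBl, tpureBr, linearB).
have t0 := (tpure0l, tpure0r, raddf0).
elim/tensor_ind=> [|y p|x y Hx Hy]; [by rewrite !t0| |]; last first.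
  by rewrite !linearB Hx Hy.
elim/tensor_ind: y => [|x m3|x y Hx Hy]; [by rewrite !t0| |]; last first.
  by rewrite tpureBl !linearB Hx Hy.
elim/tensor_ind: x => [|m1 m2|x y Hx Hy]; [by rewrite !t0| |]; last first.
  by rewrite !tpureBl !linearB Hx Hy.
rewrite bmapE assocE !gamma2E /=.
(* Both sides are additive in the value of h, then of g, then of f, so that each
   of these values may in turn be taken to be a pure tensor. *)
elim/tensor_ind: (h _) => [|q n3|x y Hx Hy]; [by rewrite !t0| |]; last first.
  by rewrite !tB Hx Hy.
rewrite !assocVE !bmapE gamma2E.
elim/tensor_ind: (g _) => [|q' n2|x y Hx Hy]; [by rewrite !t0| |]; last first.
  by rewrite !tB Hx Hy.
rewrite assocE !assocVE !bmapE.
elim/tensor_ind: (f _) => [|q'' n1|x y Hx Hy]; [by rewrite !t0| |]; last first.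
  by rewrite !tB Hx Hy.
by rewrite !assocE bmapE assocE.
Qed.

End Intertwining.

Section IteratedGamma.
Variables (R S : pzRingType) (P : bimodType R S).
Variables (M : bimodType R R) (N : bimodType S S).
Variable f : bimHom (M *ox P) (P *ox N).

(** Gamma of a + b copies is Gamma of a copies paired with Gamma of b copies:
    peel off the first f by associativity and recurse. *)
Lemma gamma_add a b :
  intertwines (tpow_add M a b) (tpow_add N a b)
    (gamma2 (gamma f a.+1) (gamma f b.+1)) (gamma f (a.+1 + b.+1)).
Proof.
elim: a => [|a IHa]; first exact: intertwines_id.
exact: (intertwines_comp (intertwines_gamma2 (intertwines_id f) IHa)
          (intertwines_assoc f (gamma f a.+1) (gamma f b.+1))).
Qed.

Lemma gamma_cast m n (e : m = n) :
  intertwines (tpow_cast M e) (tpow_cast N e) (gamma f m) (gamma f n).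
Proof. by case: n / e; exact: intertwines_id. Qed.

(** Each of the n blocks of m copies is absorbed by [gamma_add]. *)
Lemma gamma_mul n m :
  intertwines (tpow_mul M n m) (tpow_mul N n m)
    (gamma (gamma f m.+1) n.+1) (gamma f (n.+1 * m.+1)).
Proof.
elim: n => [|n IHn]; first exact: gamma_cast.
exact: (intertwines_comp (@gamma_add m (m + n * m.+1))
          (intertwines_gamma2 (intertwines_id (gamma f m.+1)) IHn)).
Qed.

End IteratedGamma.

Section Transport.
Variables (R S : pzRingType) (M M' : bimodType R R) (N N' : bimodType S S).
Variables (a : bimIso M M') (b : bimIso N N').

(** An intertwined g is the transport of f up to the identity of P: the
    transported map is (id (x) b) f (a^-1 (x) id), and a is invertible. *)
Lemma K0t_transport_eq (P : modc R S)
    (f : bimHom (M *ox P) (P *ox N)) (g : bimHom (M' *ox P) (P *ox N')) :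
  intertwines a b f g ->
  K0t_transport a b (K0tclass (EndObj f)) = K0tclass (EndObj g).
Proof.
move=> fg; rewrite K0t_transportE; apply: K0tclass_iso.
have E (u : M' *ox P) : emap (transport_end a b (EndObj f)) u = g u.
  rewrite [LHS]fg bmap_comp; congr (g _); rewrite -[RHS]bmap_id.
  by apply: eq_bmap => // m; exact: bfromK.
have h u : bmap (bid P) (bid N') (emap (transport_end a b (EndObj f)) u) =
    g (bmap (bid M') (bid P) u).
  by rewrite !bmap_id E.
have k u : bmap (bid P) (bid N') (g u) =
    emap (transport_end a b (EndObj f)) (bmap (bid M') (bid P) u).
  by rewrite !bmap_id E.
by exists (@EndMor R S M' N' (transport_end a b (EndObj f)) (EndObj g) (bid P) h),
  (@EndMor R S M' N' (EndObj g) (transport_end a b (EndObj f)) (bid P) k).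
Qed.

Lemma contract_bmap (P : bimodType R S) (c : rlin P S^o) (w : P *ox N) :
  contract c (bmap (bid P) b w) = b (contract c w).
Proof.
move: w; apply: (@tensor_ext S P N N' (contract c \o bmap (bid P) b)
  (b \o contract c)) => p n.
by rewrite /= bmapE !contractE /= linearZ.
Qed.

(** The trace is natural in (M, N): a dual basis of P serves for both an
    endomorphism and its transport, and b can be pulled out of each summand of
    the trace by [contract_bmap]. *)
Lemma tr_transport (phi : K0t M N) (x : shadow M) :
  shadow_map b (homg_fun (tr M N phi) x) =
  homg_fun (tr M' N' (K0t_transport a b phi)) (shadow_map a x).
Proof.
have [m ->] := zpi_surj x; rewrite -/(sh m) shadow_mapE.
elim/K0t_ind: phi => [|y|y Hy|y z Hy Hz].
- by rewrite !abhom0 /= raddf0.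
- rewrite K0t_transportE !trE /homg_fun !traceE /trace_fun raddf_sum.
  apply: eq_bigr => i _; rewrite shadow_mapE -contract_bmap.
  by congr (sh (contract _ (bmap _ _ (emap y _)))); rewrite bmapE btoK.
- by rewrite !abhomN /= raddfN Hy.
- by rewrite !abhomD /= raddfD Hy Hz.
Qed.
End Transport.

Theorem theorem1p3 (R S : pzRingType) (M : bimodType R R) (N : bimodType S S)
    (M_flat : flat M) :
  [/\ forall n : nat,
        (forall phi psi : K0t M N,
           frob M N n.+1 (phi + psi)%AB
           = (frob M N n.+1 phi + frob M N n.+1 psi)%AB)
        /\ (forall (P : modc R S) (f : bimHom (M *ox P) (P *ox N)),
              frob M N n.+1 (K0tclass (EndObj f))
              = K0tclass (EndObj (gamma f n.+1))),
      forall (n m : nat) (phi : K0t M N),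
        K0t_transport (tpow_mul M n m) (tpow_mul N n m)
          (frob (tpow M m.+1) (tpow N m.+1) n.+1 (frob M N m.+1 phi))
        = frob M N (n.+1 * m.+1) phi
    & forall (n : nat) (phi : K0t M N) (i : nat)
             (x : shadow (tpow (tpow M n.+1) i.+1)),
        shadow_map (tpow_mul N i n)
          (homg_fun (trace_iter (frob M N n.+1 phi) i.+1) x)
        = homg_fun (tr (tpow M (i.+1 * n.+1)) (tpow N (i.+1 * n.+1))
                       (frob M N (i.+1 * n.+1) phi))
            (shadow_map (tpow_mul M i n) x)].
Proof.
have frob_mul n m (phi : K0t M N) :
    K0t_transport (tpow_mul M n m) (tpow_mul N n m)
      (frob (tpow M m.+1) (tpow N m.+1) n.+1 (frob M N m.+1 phi))
    = frob M N (n.+1 * m.+1) phi.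
  elim/K0t_ind: phi => [|[P f]|y Hy|y z Hy Hz].
  - by rewrite !abhom0.
  - rewrite !frobE; apply: K0t_transport_eq; exact: gamma_mul.
  - by rewrite !abhomN Hy.
  - by rewrite !abhomD Hy Hz.
split=> [n|//|n phi i x]; last by rewrite -frob_mul; exact: tr_transport.
by split=> [phi psi|P f]; [exact: abhomD | exact: frobE].
Qed.
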